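(* Let $G$ be an arbitrary group and let $H=\bigoplus_{g\in G}H_g$ be a faithfully $G$-graded quasi-Hopf algebra over a field $\Bbbk$. The assignments \[ I\longmapsto\left(N,\ J,\ (I\cap H_N)/J^N\right) \qquad\text{and}\qquad (N,J,L)\longmapsto\sum_{\bar g\in G/N}H_{\bar g}K_L, \] where $N:=N_I$ and $J:=I\cap H_e$ in the first assignment and, in the second, $K_L\subseteq H_N$ denotes the inverse image of $L$ under the quotient map $H_N\to H_N/J^N$, define a bijective correspondence between the set of quasi-Hopf ideals of $H$ and the set of reduced admissible data $(N,J,L)$ for $H$.
   Context: Conventions. $\Bbbk$ is a field; vector spaces, algebras and tensor products are over $\Bbbk$; algebras are unital and algebra (anti-)morphisms preserve units. For subspaces $U,V$ of an algebra, $UV$ is the linear span of the products $uv$. Summation is suppressed: $\Delta(x)=x'\otimes x''$, $\Phi=\Phi^{(1)}\otimes\Phi^{(2)}\otimes\Phi^{(3)}$, $\Phi^{-1}=\Phi^{(-1)}\otimes\Phi^{(-2)}\otimes\Phi^{(-3)}$. Quasi-Hopf algebras. A quasi-Hopf algebra is an algebra $H$ with algebra morphisms $\Delta\colon H\to H\otimes H$, $\varepsilon\colon H\to\Bbbk$, an invertible $\Phi\in H^{\otimes 3}$, an algebra anti-morphism $S\colon H\to H$ (not assumed bijective) and elements $\alpha,\beta\in H$ such that for all $x\in H$: $(1\otimes\Phi)(\mathrm{id}\otimes\Delta\otimes\mathrm{id})(\Phi)(\Phi\otimes1)=(\mathrm{id}\otimes\mathrm{id}\otimes\Delta)(\Phi)(\Delta\otimes\mathrm{id}\otimes\mathrm{id})(\Phi)$;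 $\Phi(\Delta\otimes\mathrm{id})(\Delta(x))=(\mathrm{id}\otimes\Delta)(\Delta(x))\Phi$; $(\mathrm{id}\otimes\varepsilon\otimes\mathrm{id})(\Phi)=1\otimes1$; $(\mathrm{id}\otimes\varepsilon)\Delta(x)=x=(\varepsilon\otimes\mathrm{id})\Delta(x)$; $S(x')\alpha x''=\varepsilon(x)\alpha$; $x'\beta S(x'')=\varepsilon(x)\beta$; $\Phi^{(1)}\beta S(\Phi^{(2)})\alpha\Phi^{(3)}=1=S(\Phi^{(-1)})\alpha\Phi^{(-2)}\beta S(\Phi^{(-3)})$. Throughout, $(\alpha,\beta)$ is normalized by $\varepsilon(\alpha)=\varepsilon(\beta)=1$. A morphism of quasi-Hopf algebras is an algebra morphism commuting with $\Delta,\varepsilon,S$ and carrying $\Phi,\alpha,\beta$ to $\Phi,\alpha,\beta$. A quasi-Hopf ideal of $H$ is a two-sided ideal $I$ with $\Delta(I)\subseteq I\otimes H+H\otimes I$, $\varepsilon(I)=0$, $S(I)\subseteq I$; then $H/I$ has a unique quasi-Hopf structure making $H\to H/I$ a morphism. Gradings. For a group $G$ with identity $e$, a $G$-graded quasi-Hopf algebra is a quasi-Hopf algebra with a vector space decomposition $H=\bigoplus_{g\in G}H_g$ such that $H_gH_h\subseteq H_{gh}$, $\Delta(H_g)\subseteq H_g\otimes H_g$, $S(H_g)\subseteq H_{g^{-1}}$, $\Phi\in H_e^{\otimes3}$, $\alpha,\beta\in H_e$. It is faithfully graded if $H_g\neq0$ for all $g\in G$, and strongly graded if $H_gH_h=H_{gh}$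 for all $g,h$ (a faithful grading of a quasi-Hopf algebra is automatically strong). The group algebra $\Bbbk[G]$ has basis $\{\zeta_g\}_{g\in G}$, $\zeta_g\zeta_h=\zeta_{gh}$, with every $\zeta_g$ group-like. The grading map of a faithfully graded $H$ is $\pi\colon H\to\Bbbk[G]$, $\pi(x_g)=\varepsilon(x_g)\zeta_g$ for $x_g\in H_g$. For a subgroup $N$, $\mathfrak{a}_N$ is the augmentation ideal of $\Bbbk[N]$ (the span of $\zeta_n-\zeta_e$, $n\in N$). Subgroups. For $N\unlhd G$ and $\bar g=gN\in G/N$ put $H_{\bar g}=\bigoplus_{n\in N}H_{gn}$ and $H_N=H_{\bar e}=\bigoplus_{n\in N}H_n$, a quasi-Hopf subalgebra of $H$. For a quasi-Hopf ideal $I$ of $H$, $N_I$ is the unique normal subgroup of $G$ with $\pi(I)=\mathfrak{a}_{N_I}\cdot\Bbbk[G]$; explicitly $N_I=\{g\in G\mid\zeta_g-\zeta_e\in\pi(I)\}$. Lifted quotients. An ideal $J$ of $H_e$ is $G$-invariant if $H_gJ=JH_g$ for all $g\in G$. For a $G$-invariant quasi-Hopf ideal $J\subseteq H_e$, put $J^G:=HJ=\sum_{g}H_gJ$ and $J^N:=H_NJ$. These are quasi-Hopf ideals of $H$ and $H_N$ respectively, $J^N=J^G\cap H_N$ and $J^N\cap H_e=J$. Let $q_J\colon H\to H/J^G$ be the projection. The lifted quotient $H_N/J^N$ is strongly $N$-graded by the images of the $H_n$; its neutral component is identified with $H_e/J$, and $H_N/J^N$ is identified with $q_J(H_N)\subseteq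 H/J^G$. Its grading map is $\pi_{N,J}\colon H_N/J^N\to\Bbbk[N]$, sending the class of $x_n\in H_n$ to $\varepsilon(x_n)\zeta_n$. The algebra $H/J^G$ is strongly $G/N$-graded with components $q_J(H_{\bar g})$. Reduced admissible data. A reduced admissible datum for $H$ is a triple $(N,J,L)$ such that (i) $N\unlhd G$; (ii) $J\subseteq H_e$ is a $G$-invariant quasi-Hopf ideal of $H_e$; (iii) $L\subseteq H_N/J^N$ is a quasi-Hopf ideal; (iv) $L\cap(H_e/J)=0$; (v) $\mathfrak{a}_N\subseteq\pi_{N,J}(L)$; (vi) $q_J(H_{\bar g})L=Lq_J(H_{\bar g})$ for all $\bar g\in G/N$. *)

(* Defs.v *)
From HB Require Import structures.
From mathcomp Require Import all_boot all_order all_algebra.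
From mathcomp Require Import boolp classical_sets.
From mathcomp Require Import finmap monalg.

Set Implicit Arguments.
Unset Strict Implicit.
Unset Printing Implicit Defensive.

Import GRing.Theory.
Local Open Scope quotient_scope.
Local Open Scope classical_set_scope.
Local Open Scope ring_scope.

Reserved Notation "u \ox v" (at level 40, left associativity).

Section Subspaces.
Context (k : fieldType).

Definition subspace (V : lmodType k) (W : set V) : Prop :=
  W 0 /\ forall (a : k) x y, W x -> W y -> W (a *: x + y).

Definition lspan (V : lmodType k) (A : set V) : set V := smallest (@subspace V) A.

Definition prodset (A : algType k) (U V : set A) : set A :=
  lspan [set u * v | u in U & v in V].

Context (V : lmodType k).
Implicit Types (W A : set V).

Lemma subspaceD W : subspace W -> forall x y, W x -> W y -> W (x + y).
Proof. by move=> [_ h] x y hx hy; rewrite -[x]scale1r; apply: h. Qed.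

Lemma subspaceZ W : subspace W -> forall a x, W x -> W (a *: x).
Proof. by move=> [h0 h] a x hx; rewrite -[_ *: _]addr0; apply: h. Qed.

Lemma subspaceN W : subspace W -> forall x, W x -> W (- x).
Proof. by move=> h x hx; rewrite -scaleN1r; apply: subspaceZ. Qed.

Lemma subspaceB W : subspace W -> forall x y, W x -> W y -> W (x - y).
Proof. by move=> h x y hx hy; apply: subspaceD=> //; apply: subspaceN. Qed.

Lemma subspace_sum W : subspace W ->
  forall (I : Type) (r : seq I) (P : pred I) (F : I -> V),
  (forall i, P i -> W (F i)) -> W (\sum_(i <- r | P i) F i).
Proof.
move=> h I r P F hF; apply: (big_ind W) => //; first by case: h.
exact: subspaceD.
Qed.

Lemma lspan_subspace A : subspace (lspan A).
Proof.
split=> [W [[W0 _] _] //|a x y hx hy W hW].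
by case: (hW) => [[_ h] _]; apply: h; [apply: hx|apply: hy].
Qed.

Lemma sub_lspan A : A `<=` lspan A.
Proof. exact: sub_gen_smallest. Qed.

Lemma lspan_sub A W : subspace W -> A `<=` W -> lspan A `<=` W.
Proof. exact: smallest_sub. Qed.

Lemma subspace_setT : subspace [set: V].
Proof. by []. Qed.

Lemma subspace_set0 : subspace [set 0 : V].
Proof. by split=> // a x y /= -> ->; rewrite scaler0 addr0. Qed.

End Subspaces.

Section LinearHelpers.
Context (k : fieldType) (U V : lmodType k) (f : U -> V) (hf : linear f).

Lemma linD x y : f (x + y) = f x + f y.
Proof. by rewrite -[x]scale1r hf !scale1r. Qed.

Lemma lin0 : f 0 = 0.
Proof. by apply: (@addrI _ (f 0)); rewrite -linD !addr0. Qed.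

Lemma linZ a x : f (a *: x) = a *: f x.
Proof. by rewrite -[a *: x]addr0 hf lin0 addr0. Qed.

Lemma linB x y : f (x - y) = f x - f y.
Proof. by rewrite linD -scaleN1r linZ scaleN1r. Qed.

Lemma lin_sum (I : Type) (r : seq I) (P : pred I) (F : I -> U) :
  f (\sum_(i <- r | P i) F i) = \sum_(i <- r | P i) f (F i).
Proof. by apply: big_morph; [apply: linD|apply: lin0]. Qed.

Lemma preim_subspace W : subspace W -> subspace (f @^-1` W).
Proof.
by move=> [h0 h]; split=> [|a x y hx hy]; rewrite /preimage /= ?lin0 ?hf //; apply: h.
Qed.

Lemma image_subspace W : subspace W -> subspace (f @` W).
Proof.
move=> [h0 h]; split=> [|a _ _ [x hx <-] [y hy <-]]; first by exists 0; rewrite ?lin0.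
by exists (a *: x + y); rewrite ?hf //; apply: h.
Qed.

End LinearHelpers.

Lemma linear_of (k : fieldType) (U V : lmodType k) (f : {linear U -> V}) : linear f.
Proof. by move=> a x y; rewrite linearP. Qed.

Record subsp (k : fieldType) (V : lmodType k) := Subsp {
  subsp_set :> set V;
  subspP : subspace subsp_set }.

Section ModuleQuotient.
Context (k : fieldType) (V : lmodType k) (W : subsp V).

Definition qrel : rel V := fun x y => `[< subsp_set W (x - y) >].

Lemma qrel_refl : reflexive qrel.
Proof. by move=> x; apply/asboolP; rewrite subrr; case: (subspP W). Qed.

Lemma qrel_sym : symmetric qrel.
Proof.
suff h x y : qrel x y -> qrel y x by move=> x y; apply/idP/idP; apply: h.
move=> /asboolP h; apply/asboolP; rewrite -opprB.
exact: subspaceN (subspP W) _ h.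
Qed.

Lemma qrel_trans : transitive qrel.
Proof.
move=> y x z /asboolP h1 /asboolP h2; apply/asboolP.
by rewrite -[x](subrK y) -addrA; apply: subspaceD (subspP W) _ _ h1 h2.
Qed.

Canonical qrel_equiv := EquivRel qrel qrel_refl qrel_sym qrel_trans.

Definition qmod := {eq_quot qrel}.
HB.instance Definition _ := Choice.on qmod.

Definition qproj (x : V) : qmod := \pi_{eq_quot qrel} x.

Lemma qproj_eq x y : qproj x = qproj y <-> subsp_set W (x - y).
Proof. by split=> [/eqmodP/asboolP|h]//; apply/eqmodP/asboolP. Qed.

Lemma qprojK (x : qmod) : qproj (repr x) = x.
Proof. exact: reprK. Qed.

Lemma qproj_repr (x : V) : subsp_set W (repr (qproj x) - x).
Proof. by apply/qproj_eq; rewrite qprojK. Qed.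

Definition qadd (x y : qmod) : qmod := qproj (repr x + repr y).
Definition qopp (x : qmod) : qmod := qproj (- repr x).
Definition qscale (a : k) (x : qmod) : qmod := qproj (a *: repr x).

Lemma qaddE x y : qadd (qproj x) (qproj y) = qproj (x + y).
Proof.
apply/qproj_eq; rewrite opprD addrACA.
by apply: subspaceD (subspP W) _ _ _ _; apply: qproj_repr.
Qed.

Lemma qoppE x : qopp (qproj x) = qproj (- x).
Proof.
by apply/qproj_eq; rewrite -opprD; apply: subspaceN (subspP W) _ _; apply: qproj_repr.
Qed.

Lemma qscaleE a x : qscale a (qproj x) = qproj (a *: x).
Proof.
by apply/qproj_eq; rewrite -scalerBr; apply: subspaceZ (subspP W) _ _ _; apply: qproj_repr.
Qed.

Lemma qaddA : associative qadd.
Proof.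
by move=> x y z; rewrite -(qprojK x) -(qprojK y) -(qprojK z) !qaddE addrA.
Qed.

Lemma qaddC : commutative qadd.
Proof. by move=> x y; rewrite /qadd addrC. Qed.

Lemma qadd0 : left_id (qproj 0) qadd.
Proof. by move=> x; rewrite -(qprojK x) qaddE add0r. Qed.

Lemma qaddN : left_inverse (qproj 0) qopp qadd.
Proof. by move=> x; rewrite -(qprojK x) qoppE qaddE addNr. Qed.

HB.instance Definition _ := GRing.isZmodule.Build qmod qaddA qaddC qadd0 qaddN.

Lemma qscaleA a b x : qscale a (qscale b x) = qscale (a * b) x.
Proof. by rewrite -(qprojK x) !qscaleE scalerA. Qed.

Lemma qscale1 : left_id 1 qscale.
Proof. by move=> x; rewrite -(qprojK x) qscaleE scale1r. Qed.

Lemma qscaleDr : right_distributive qscale +%R.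
Proof.
by move=> a x y; rewrite -(qprojK x) -(qprojK y) [_ + _]qaddE !qscaleE [RHS]qaddE scalerDr.
Qed.

Lemma qscaleDl x : {morph qscale^~ x : a b / a + b}.
Proof. by move=> a b; rewrite -(qprojK x) !qscaleE [RHS]qaddE scalerDl. Qed.

HB.instance Definition _ :=
  GRing.Zmodule_isLmodule.Build k qmod qscaleA qscale1 qscaleDr qscaleDl.

Lemma qproj_linear : linear qproj.
Proof.
move=> a x y; have -> : a *: qproj x = qproj (a *: x) := qscaleE a x.
by rewrite [RHS]qaddE.
Qed.

HB.instance Definition _ := GRing.isLinear.Build k V qmod _ qproj qproj_linear.

Lemma qproj_eq0 x : qproj x = 0 <-> subsp_set W x.
Proof. by rewrite -[0](linear0 qproj) qproj_eq subr0. Qed.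

End ModuleQuotient.

Section Functionals.
Context (k : fieldType) (V : lmodType k).

Lemma functional_sep (W : set V) (x : V) : subspace W -> ~ W x ->
  exists f : V -> k^o, [/\ linear f, forall y, W y -> f y = 0 & f x = 1].
Proof.
move=> hW Wx.
pose P (X : set V) := X = set0 \/ [/\ subspace X, W `<=` X & ~ X x].
have [|A [PA maxA]] := @Zorn_bigcup V P.
  move=> F FP totF.
  have [[X0 [FX0 X0n]]|F0] := pselect (exists X, F X /\ X <> set0); last first.
    left; rewrite -subset0 => y [X FX Xy].
    by apply: F0; exists X; split=> // X0; rewrite X0 in Xy.
  have FP' X y : F X -> X y -> [/\ subspace X, W `<=` X & ~ X x].
    by move=> FX Xy; case: (FP X FX) => // XE; rewrite XE in Xy.
  have [y0 X0y] : exists y, X0 y by have /eqP/set0P := X0n.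
  have [X0s WX0 _] := FP' _ _ FX0 X0y.
  right; split.
  - split; first by exists X0 => //; case: X0s.
    move=> a y z [Y FY Yy] [Z FZ Zz].
    have [[_ Ys] _ _] := FP' _ _ FY Yy; have [[_ Zs] _ _] := FP' _ _ FZ Zz.
    have [YZ|ZY] := totF _ _ FY FZ.
      by exists Z => //; apply: Zs => //; apply: YZ.
    by exists Y => //; apply: Ys => //; apply: ZY.
  - by move=> y Wy; exists X0 => //; apply: WX0.
  - by move=> [X FX Xx]; have [_ _ /(_ Xx)] := FP' _ _ FX Xx.
have W0 : W 0 by case: hW.
case: PA => [A0|[As WA Ax]].
  exfalso; apply: (maxA W); last by right; split.
  rewrite A0; split; first exact: sub0set.
  by move=> /(_ 0 W0).
pose B c y := A (y - c *: x).
have exB y : exists c, B c y.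
  apply: contrapT => nB.
  have Ay : ~ A y by move=> Ay; apply: nB; exists 0; rewrite /B scale0r subr0.
  pose C := [set z | exists a, A (z - a *: y)].
  have Cs : subspace C.
    split; first by exists 0; rewrite scale0r subr0; case: As.
    move=> a u v [b Ab] [c Ac]; exists (a * b + c).
    have -> : a *: u + v - (a * b + c) *: y = a *: (u - b *: y) + (v - c *: y).
      by rewrite scalerBr scalerA scalerDl opprD addrACA.
    by case: As => _; apply.
  apply: (maxA C).
    split; first by move=> z Az; exists 0; rewrite scale0r subr0.
    move=> /(_ y) CA; apply: Ay; apply: CA; exists 1.
    by rewrite scale1r subrr; case: As.
  right; split=> //.
    by move=> z Wz; exists 0; rewrite scale0r subr0; apply: WA.
  move=> [a Aa]; have [a0|a0] := eqVneq a 0.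
    by apply: Ax; move: Aa; rewrite a0 scale0r subr0.
  apply: nB; exists a^-1; rewrite /B.
  have -> : y - a^-1 *: x = - a^-1 *: (x - a *: y).
    by rewrite scalerBr !scaleNr scalerA mulVf // scale1r opprK addrC.
  exact: subspaceZ.
have uniqB y c d : B c y -> B d y -> c = d.
  move=> hc hd; apply: contrapT => /eqP cd.
  apply: Ax; have := subspaceZ As (c - d)^-1 (subspaceB As hd hc).
  have -> : y - d *: x - (y - c *: x) = (c - d) *: x.
  by rewrite opprB scalerBl addrC addrA subrK.
by rewrite scalerA mulVf ?scale1r // subr_eq0.
pose f y : k^o := sval (cid (exB y)).
have fB y : B (f y) y := svalP (cid (exB y)).
exists f; split.
- move=> a y z; apply: uniqB (fB _) _.
  rewrite /B; have -> : a *: y + z - (a *: f y + f z) *: x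
      = a *: (y - f y *: x) + (z - f z *: x).
    by rewrite scalerBr scalerA scalerDl opprD addrACA.
  by case: As => _; apply; apply: fB.
- by move=> y Wy; apply: uniqB (fB _) _; rewrite /B scale0r subr0; apply: WA.
- by apply: uniqB (fB _) _; rewrite /B scale1r subrr; case: As.
Qed.

End Functionals.

Section FormalSums.
Context (k : fieldType) (K : choiceType) (W : lmodType k) (phi : K -> W).

Definition mlin (D : {malg k[K]}) : W := \sum_(g <- msupp D) D@_g *: phi g.

Lemma mlinEw (E : {fset K}) D : (msupp D `<=` E)%fset ->
  mlin D = \sum_(g <- E) D@_g *: phi g.
Proof.
move=> DE; rewrite /mlin (big_fset_incl _ DE) // => g _.
by move=> /mcoeff_outdom ->; rewrite scale0r.
Qed.

Lemma mlin_linear : linear mlin.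
Proof.
move=> a D E; pose F := (msupp D `|` msupp E)%fset.
rewrite (@mlinEw F D) ?fsubsetUl // (@mlinEw F E) ?fsubsetUr //.
rewrite (@mlinEw F (a *: D + E)).
  rewrite scaler_sumr -big_split /=.
  by apply: eq_bigr => g _; rewrite mcoeffD mcoeffZ scalerDl scalerA.
apply: fsubset_trans (msuppD_le _ _) _.
by apply: fsetSU; apply: msuppZ_le.
Qed.

Lemma mlinU c g : mlin << c *g g >> = c *: phi g.
Proof. by rewrite (@mlinEw [fset g]%fset) ?msuppU_le // big_seq_fset1 mcoeffUU. Qed.

Lemma mlinU1 g : mlin << g >> = phi g.
Proof. by rewrite mlinU scale1r. Qed.

End FormalSums.

Definition bilin (k : fieldType) (U V W : lmodType k) (f : U -> V -> W) : Prop :=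
  (forall v, linear (f^~ v)) /\ (forall u, linear (f u)).

(* The factors are algebras only because nested tensor products are then elaborated
   with a unique module structure on their factors; the multiplications play no role
   in this section. *)
Section Tensor.
Context (k : fieldType) (U V : algType k).

Let F := {malg k[(U * V)%type]}.
Let gen (u : U) (v : V) : F := << (u, v) >>.

(* [U \ox V] is the free vector space on [U * V] modulo the span of the
   bilinearity relations. *)
Definition tensor_rel : set F :=
  [set r | (exists a u u' v, r = gen (a *: u + u') v - (a *: gen u v + gen u' v)) \/
           (exists a u v v', r = gen u (a *: v + v') - (a *: gen u v + gen u v'))].

Definition tensor_subsp : subsp F := Subsp (lspan_subspace tensor_rel).

Definition tensor := qmod tensor_subsp.
HB.instance Definition _ := GRing.Lmodule.on tensor.

Definition tpure (u : U) (v : V) : tensor := qproj tensor_subsp (gen u v).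

(* [tsum f t] is [\sum f u v] over any presentation of [t] as a sum of [u \ox v]
   (see [tsum_pure], [tsum_linear]); it is only meaningful for bilinear [f]. *)
Definition tsum (W : lmodType k) (f : U -> V -> W) (t : tensor) : W :=
  mlin (fun p => f p.1 p.2) (repr t : F).

Lemma tpure_bilin : bilin tpure.
Proof.
have ql := qproj_linear tensor_subsp.
split=> [v a u u'|u a v v']; rewrite /tpure -ql; apply/qproj_eq;
  apply: sub_lspan; [left|right].
- by exists a, u, u', v.
- by exists a, u, v, v'.
Qed.

Lemma tens_sum (t : tensor) :
  t = \sum_(p <- msupp (repr t : F)) (repr t : F)@_p *: tpure p.1 p.2.
Proof.
have ql := qproj_linear tensor_subsp.
rewrite -{1}(qprojK (W := tensor_subsp) t) {1}(monalgE (repr t : F)).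
rewrite (lin_sum ql); apply: eq_bigr => -[u v] _ /=.
rewrite /tpure -(linZ ql); congr (qproj _ _).
by apply/malgP=> p; rewrite mcoeffZ !mcoeffU mulrnAr mulr1.
Qed.

Section Lift.
Context (W : lmodType k).
Implicit Types f : U -> V -> W.

Let ev f : F -> W := mlin (fun p => f p.1 p.2).

Lemma tsum_proj f x : bilin f -> tsum f (qproj tensor_subsp x) = ev f x.
Proof.
move=> [fl fr]; apply/eqP; rewrite -subr_eq0 -(linB (mlin_linear _)); apply/eqP.
suff h : lspan tensor_rel `<=` ev f @^-1` [set 0].
  exact: h (qproj_repr tensor_subsp x).
apply: lspan_sub.
  apply: preim_subspace; [exact: mlin_linear|exact: subspace_set0].
move=> r [] [a [u [u' [v ->]]]];
  rewrite /preimage /= /ev (linB (mlin_linear _)) (mlin_linear _) !mlinU1 /=.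
- by rewrite fl subrr.
- by rewrite fr subrr.
Qed.

Lemma tsum_pure f u v : bilin f -> tsum f (tpure u v) = f u v.
Proof. by move=> hf; rewrite /tpure tsum_proj // /ev mlinU1. Qed.

Lemma tsum_linear f : bilin f -> linear (tsum f).
Proof.
move=> hf a s t; have ql := qproj_linear tensor_subsp.
rewrite -(qprojK (W := tensor_subsp) s) -(qprojK (W := tensor_subsp) t) -ql.
by rewrite !tsum_proj //; apply: mlin_linear.
Qed.

Lemma tens_ext (f g : tensor -> W) : linear f -> linear g ->
  (forall u v, f (tpure u v) = g (tpure u v)) -> f =1 g.
Proof.
move=> hf hg h t; rewrite (tens_sum t) (lin_sum hf) (lin_sum hg).
by apply: eq_bigr => p _; rewrite (linZ hf) (linZ hg) h.
Qed.

Lemma eq_tsum f g : (forall u v, f u v = g u v) -> tsum f =1 tsum g.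
Proof. by move=> h t; apply: eq_bigr => p _; rewrite h. Qed.

End Lift.

Lemma tsum_lin (W W' : lmodType k) (h : W -> W') (f : U -> V -> W) t :
  linear h -> h (tsum f t) = tsum (fun u v => h (f u v)) t.
Proof.
by move=> hl; rewrite /tsum /mlin (lin_sum hl); apply: eq_bigr => p _; rewrite linZ.
Qed.

Lemma tsumP (W : lmodType k) (f : U -> V -> W) : bilin f ->
  exists! F : tensor -> W, linear F /\ forall u v, F (tpure u v) = f u v.
Proof.
move=> hf; exists (tsum f); split.
  by split=> [|u v]; [apply: tsum_linear|apply: tsum_pure].
move=> g [gl gE]; apply/funext/tens_ext => //; first exact: tsum_linear.
by move=> u v; rewrite gE tsum_pure.
Qed.

Lemma tensor_ind (P : set tensor) : subspace P ->
  (forall u v, P (tpure u v)) -> forall t, P t.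
Proof.
move=> hP h t; rewrite (tens_sum t); apply: subspace_sum => // p _.
exact: subspaceZ.
Qed.

Definition ttens (A : set U) (B : set V) : set tensor :=
  lspan [set tpure u v | u in A & v in B].

Lemma tpure_neq0 u v : u <> 0 -> v <> 0 -> tpure u v <> 0.
Proof.
move=> u0 v0 uv.
have [f [fl _ fu]] := @functional_sep k U [set 0] u (subspace_set0 _) u0.
have [g [gl _ gv]] := @functional_sep k V [set 0] v (subspace_set0 _) v0.
pose b u v : k^o := f u * g v.
have hb : bilin b.
  split=> [y a x x'|x a y y']; rewrite /b ?fl ?gl /=.
    by rewrite mulrDl -scalerAl.
  by rewrite mulrDr -scalerAr.
have := tsum_pure u v hb; rewrite uv (lin0 (tsum_linear hb)) /b fu gv mulr1.
by move=> /esym/eqP; rewrite oner_eq0.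
Qed.

End Tensor.

Arguments ttens {k U V} A B.
Arguments tpure {k U V} u v.
Arguments tpure_bilin {k} U V.
Notation "U \ox V" := (tensor U%type V%type) : type_scope.
Notation "u \ox v" := (tpure u v) : ring_scope.

Section TensorBilinear.
Context (k : fieldType) (U V : algType k).

Lemma tpurePl a (u u' : U) (v : V) : (a *: u + u') \ox v = a *: (u \ox v) + u' \ox v.
Proof. exact: (tpure_bilin U V).1. Qed.

Lemma tpurePr a (u : U) (v v' : V) : u \ox (a *: v + v') = a *: (u \ox v) + u \ox v'.
Proof. exact: (tpure_bilin U V).2. Qed.

Lemma tsum_param (X W : lmodType k) (f : X -> U -> V -> W) t :
  (forall u v, linear (fun x => f x u v)) -> linear (fun x => tsum (f x) t).
Proof.
move=> h a x y; rewrite /tsum /mlin scaler_sumr -big_split /=.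
by apply: eq_bigr => p _; rewrite h scalerDr !scalerA mulrC.
Qed.

Lemma bilin_tsum_r (X W : lmodType k) (f : X -> U -> V -> W) :
  (forall x, bilin (f x)) -> (forall u v, linear (fun x => f x u v)) ->
  bilin (fun x t => tsum (f x) t).
Proof.
by move=> h1 h2; split=> [t|x]; [apply: tsum_param|apply: tsum_linear].
Qed.

Lemma bilin_tsum_l (X W : lmodType k) (f : U -> V -> X -> W) :
  (forall x, bilin (fun u v => f u v x)) -> (forall u v, linear (f u v)) ->
  bilin (fun t x => tsum (fun u v => f u v x) t).
Proof.
move=> h1 h2; split=> [x|t]; first exact: tsum_linear.
exact: (@tsum_param X W (fun x u v => f u v x)).
Qed.

End TensorBilinear.

Section TensorAlgebra.
Context (k : fieldType) (A B : algType k).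

Definition tmul (s t : A \ox B) : A \ox B :=
  tsum (fun a b => tsum (fun a' b' => (a * a') \ox (b * b')) t) s.

Lemma tmul_bilin_in a b : bilin (fun (a' : A) (b' : B) => (a * a') \ox (b * b')).
Proof.
by split=> [b'|a'] c x y; rewrite mulrDr -scalerAr ?tpurePl ?tpurePr.
Qed.

Lemma tmul_bilin_out t :
  bilin (fun (a : A) (b : B) => tsum (fun a' b' => (a * a') \ox (b * b')) t).
Proof.
split=> [b|a].
  apply: (@tsum_param k A B A _ (fun a a' b' => (a * a') \ox (b * b'))) => a' b' c x y.
  by rewrite mulrDl -scalerAl tpurePl.
apply: (@tsum_param k A B B _ (fun b a' b' => (a * a') \ox (b * b'))) => a' b' c x y.
by rewrite mulrDl -scalerAl tpurePr.
Qed.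

Lemma tmul_linear_l t : linear (tmul^~ t).
Proof. exact: tsum_linear (tmul_bilin_out t). Qed.

Lemma tmul_linear_r s : linear (tmul s).
Proof.
apply: (@tsum_param k A B _ _ (fun t a b => tsum (fun a' b' => (a * a') \ox (b * b')) t)).
by move=> a b; apply/tsum_linear/tmul_bilin_in.
Qed.

Lemma tmulE a b a' b' : tmul (a \ox b) (a' \ox b') = (a * a') \ox (b * b').
Proof.
rewrite /tmul tsum_pure; last exact: tmul_bilin_out.
by rewrite tsum_pure //; apply: tmul_bilin_in.
Qed.

Lemma linear_comp (U V W : lmodType k) (f : V -> W) (g : U -> V) :
  linear f -> linear g -> linear (fun x => f (g x)).
Proof. by move=> hf hg a x y; rewrite hg hf. Qed.

Lemma tmulA : associative tmul.
Proof.
move=> r s t; move: r; apply: tens_ext.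
- exact: tmul_linear_l.
- exact: linear_comp (tmul_linear_l _) (tmul_linear_l _).
move=> a b; move: s; apply: tens_ext.
- exact: linear_comp (tmul_linear_r _) (tmul_linear_l _).
- exact: linear_comp (tmul_linear_l _) (tmul_linear_r _).
move=> a' b'; move: t; apply: tens_ext.
- exact: linear_comp (tmul_linear_r _) (tmul_linear_r _).
- exact: tmul_linear_r.
by move=> a'' b''; rewrite !tmulE !mulrA.
Qed.

Lemma linear_id (U : lmodType k) : linear (fun x : U => x).
Proof. by []. Qed.

Lemma tmul1 : left_id (1 \ox 1) tmul.
Proof.
apply: tens_ext; [exact: tmul_linear_r|exact: linear_id|].
by move=> a b; rewrite tmulE !mul1r.
Qed.

Lemma tmulr1 : right_id (1 \ox 1) tmul.
Proof.
apply: tens_ext; [exact: tmul_linear_l|exact: linear_id|].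
by move=> a b; rewrite tmulE !mulr1.
Qed.

Lemma tmulDl : left_distributive tmul +%R.
Proof. by move=> s t r; rewrite (linD (tmul_linear_l r)). Qed.

Lemma tmulDr : right_distributive tmul +%R.
Proof. by move=> s t r; rewrite (linD (tmul_linear_r s)). Qed.

Lemma tone_neq0 : 1 \ox 1 != 0 :> A \ox B.
Proof. by apply/eqP; apply: tpure_neq0; apply/eqP/oner_neq0. Qed.

HB.instance Definition _ := GRing.Zmodule_isNzRing.Build (A \ox B)%type
  tmulA tmul1 tmulr1 tmulDl tmulDr tone_neq0.

Lemma tscaleAl c (s t : A \ox B) : c *: (s * t) = (c *: s) * t.
Proof. by rewrite [RHS](linZ (tmul_linear_l t)). Qed.

HB.instance Definition _ := GRing.Lmodule_isLalgebra.Build k (A \ox B)%type tscaleAl.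

Lemma tscaleAr c (s t : A \ox B) : c *: (s * t) = s * (c *: t).
Proof. by rewrite [RHS](linZ (tmul_linear_r s)). Qed.

HB.instance Definition _ := GRing.Lalgebra_isAlgebra.Build k (A \ox B)%type tscaleAr.

Lemma tmulrE (a a' : A) (b b' : B) : (a \ox b) * (a' \ox b') = (a * a') \ox (b * b').
Proof. exact: tmulE. Qed.

End TensorAlgebra.

Section TensorMaps.
Context (k : fieldType).

Definition tmap (U V U' V' : algType k) (f : U -> U') (g : V -> V') :
  U \ox V -> U' \ox V' := tsum (fun u v => f u \ox g v).

Definition tassoc (U V W : algType k) : U \ox (V \ox W) -> (U \ox V) \ox W :=
  tsum (fun u => tsum (fun v w => (u \ox v) \ox w)).

Lemma tmap_bilin (U V U' V' : algType k) (f : U -> U') (g : V -> V') :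
  linear f -> linear g -> bilin (fun u v => f u \ox g v).
Proof.
by move=> hf hg; split=> [v|u] a x y; rewrite ?hf ?hg ?tpurePl ?tpurePr.
Qed.

Lemma tmap_linear (U V U' V' : algType k) (f : U -> U') (g : V -> V') :
  linear f -> linear g -> linear (tmap f g).
Proof. by move=> hf hg; apply/tsum_linear/tmap_bilin. Qed.

Lemma tmapE (U V U' V' : algType k) (f : U -> U') (g : V -> V') u v :
  linear f -> linear g -> tmap f g (u \ox v) = f u \ox g v.
Proof. by move=> hf hg; apply/tsum_pure/tmap_bilin. Qed.

Lemma tsum_tmap (U V U' V' : algType k) (W : lmodType k) (F : U' -> V' -> W) (f : U -> U') (g : V -> V') t :
  bilin F -> tsum F (tmap f g t) = tsum (fun u v => F (f u) (g v)) t.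
Proof.
move=> hF; rewrite /tmap (tsum_lin _ _ (tsum_linear hF)).
by apply: eq_tsum => u v; rewrite tsum_pure.
Qed.

Lemma tmap_comp (U V U1 V1 U2 V2 : algType k)
  (f : U1 -> U2) (g : V1 -> V2) (f1 : U -> U1) (g1 : V -> V1) t :
  linear f -> linear g -> tmap f g (tmap f1 g1 t) = tmap (f \o f1) (g \o g1) t.
Proof. by move=> hf hg; rewrite {1}/tmap tsum_tmap //; apply: tmap_bilin. Qed.

Lemma eq_tmap (U V U' V' : algType k) (f f1 : U -> U') (g g1 : V -> V') :
  f =1 f1 -> g =1 g1 -> tmap f g =1 tmap f1 g1.
Proof. by move=> hf hg; apply: eq_tsum => u v; rewrite hf hg. Qed.

Lemma tassoc_bilin_in (U V W : algType k) u :
  bilin (fun (v : V) (w : W) => ((u : U) \ox v) \ox w).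
Proof. by split=> [w|v] a x y; rewrite ?tpurePr ?tpurePl. Qed.

Lemma tassoc_bilin (U V W : algType k) :
  bilin (fun (u : U) => tsum (fun (v : V) (w : W) => (u \ox v) \ox w)).
Proof.
apply: (@bilin_tsum_r k V W U _ (fun u v w => (u \ox v) \ox w)).
  exact: tassoc_bilin_in.
by move=> v w a x y; rewrite !tpurePl.
Qed.

Lemma tassoc_linear (U V W : algType k) : linear (@tassoc U V W).
Proof. exact/tsum_linear/tassoc_bilin. Qed.

Lemma tassocE (U V W : algType k) (u : U) (v : V) (w : W) :
  tassoc (u \ox (v \ox w)) = (u \ox v) \ox w.
Proof.
rewrite /tassoc tsum_pure; last exact: tassoc_bilin.
by rewrite tsum_pure //; apply: tassoc_bilin_in.
Qed.

Lemma tassoc_tmap (U V W U' V' W' : algType k) (f : U -> U') (g : V -> V') (h : W -> W') t :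
  linear f -> linear g -> linear h ->
  tassoc (tmap f (tmap g h) t) = tmap (tmap f g) h (tassoc t).
Proof.
move=> hf hg hh; rewrite {1}/tassoc tsum_tmap; last exact: tassoc_bilin.
rewrite [RHS](tsum_lin _ _ (tmap_linear (tmap_linear hf hg) hh)).
apply: eq_tsum => u s; rewrite tsum_tmap; last exact: tassoc_bilin_in.
rewrite (tsum_lin _ _ (tmap_linear (tmap_linear hf hg) hh)).
by apply: eq_tsum => v w; rewrite !tmapE //; apply: tmap_linear.
Qed.

End TensorMaps.

Lemma mulr_linear_l (k : fieldType) (A : algType k) (t : A) : linear (fun x => x * t).
Proof. by move=> a x y; rewrite mulrDl -scalerAl. Qed.

Lemma mulr_linear_r (k : fieldType) (A : algType k) (t : A) : linear (fun x => t * x).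
Proof. by move=> a x y; rewrite mulrDr -scalerAr. Qed.

Lemma tmap_monoid (k : fieldType) (A B A' B' : algType k) (f : A -> A') (g : B -> B') :
  linear f -> linear g -> monoid_morphism f -> monoid_morphism g ->
  monoid_morphism (tmap f g).
Proof.
move=> hf hg [f1 fM] [g1 gM]; have hfg := tmap_linear hf hg; split.
  by rewrite tmapE // f1 g1.
move=> s t; move: s; apply: tens_ext.
- exact: linear_comp hfg (mulr_linear_l t).
- exact: linear_comp (mulr_linear_l (tmap f g t)) hfg.
move=> a b; move: t; apply: tens_ext.
- exact: linear_comp hfg (mulr_linear_r (a \ox b)).
- exact: linear_comp (mulr_linear_r (tmap f g (a \ox b))) hfg.
by move=> a' b'; rewrite tmulrE !tmapE // tmulrE fM gM.
Qed.

(* [H \ox H \ox H] is [(H \ox H) \ox H], and similarly for four factors; maps that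
   bracket differently are composed with [tassoc]. *)
Record quasiHopfType (k : fieldType) := QuasiHopf {
  qh_alg :> algType k;
  Delta : {lrmorphism qh_alg -> qh_alg \ox qh_alg};
  eps : {lrmorphism qh_alg -> k^o};
  Phi : qh_alg \ox qh_alg \ox qh_alg;
  PhiI : qh_alg \ox qh_alg \ox qh_alg;
  antip : {linear qh_alg -> qh_alg};
  alpha : qh_alg;
  beta : qh_alg;
  PhiK : Phi * PhiI = 1;
  PhiIK : PhiI * Phi = 1;
  antip1 : antip 1 = 1;
  antipM : forall x y, antip (x * y) = antip y * antip x;
  pentagon :
    tmap (@tassoc k qh_alg qh_alg qh_alg) idfun (tassoc (1 \ox Phi))
      * tmap (@tassoc k qh_alg qh_alg qh_alg \o tmap idfun Delta) idfun Phi
      * (Phi \ox 1)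
    = tassoc (tmap idfun Delta Phi) * tmap (tmap Delta idfun) idfun Phi;
  quasi_coassoc : forall x,
    Phi * tmap Delta idfun (Delta x) = tassoc (tmap idfun Delta (Delta x)) * Phi;
  Phi_counit : tmap (tsum (fun a b => (eps b : k) *: a)) idfun Phi = 1;
  counitr : forall x, tsum (fun a b => (eps b : k) *: a) (Delta x) = x;
  counitl : forall x, tsum (fun a b => (eps a : k) *: b) (Delta x) = x;
  antip_alpha : forall x,
    tsum (fun a b => antip a * alpha * b) (Delta x) = (eps x : k) *: alpha;
  antip_beta : forall x,
    tsum (fun a b => a * beta * antip b) (Delta x) = (eps x : k) *: beta;
  antip_Phi :
    tsum (fun t c => tsum (fun a b => a * beta * antip b * alpha * c) t) Phi = 1;
  antip_PhiI :
    tsum (fun t c => tsum (fun a b => antip a * alpha * b * beta * antip c) t) PhiI = 1;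
  eps_alpha : eps alpha = 1;
  eps_beta : eps beta = 1
}.

Arguments Delta {k q}.
Arguments eps {k q}.
Arguments Phi {k q}.
Arguments PhiI {k q}.
Arguments antip {k q}.
Arguments alpha {k q}.
Arguments beta {k q}.

Section QuasiHopfIdeals.
Context (k : fieldType) (H : quasiHopfType k).

(* [qh_ideal A I]: [I] is a quasi-Hopf ideal of the quasi-Hopf subalgebra [A] of [H],
   where [A \ox A] is seen inside [H \ox H]; [A] is [setT] for the ideals of [H]. *)
Record qh_ideal (A I : set H) : Prop := QHIdeal {
  qhi_sub : I `<=` A;
  qhi_subspace : subspace I;
  qhi_mull : forall a x, A a -> I x -> I (a * x);
  qhi_mulr : forall a x, A a -> I x -> I (x * a);
  qhi_Delta : forall x, I x -> [set s + t | s in ttens I A & t in ttens A I] (Delta x);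
  qhi_eps : forall x, I x -> eps x = 0;
  qhi_antip : forall x, I x -> I (antip x) }.

Record qhideal := QHIdealPack {
  qhideal_set :> set H;
  qhidealP : qh_ideal [set: H] qhideal_set }.

End QuasiHopfIdeals.

Section MonoidMorphismEquations.
Context (A B : nzRingType) (f : A -> B) (hf : monoid_morphism f).

Lemma monoid_eq21 x y : x * y = 1 -> f x * f y = 1.
Proof. by case: hf => f1 fM e; rewrite -fM e. Qed.

Lemma monoid_eq22 x y s t : x * y = s * t -> f x * f y = f s * f t.
Proof. by case: hf => f1 fM e; rewrite -!fM e. Qed.

Lemma monoid_eq32 x y z s t : x * y * z = s * t -> f x * f y * f z = f s * f t.
Proof. by case: hf => f1 fM e; rewrite -!fM e. Qed.

End MonoidMorphismEquations.

Section QuasiHopfLinearity.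
Context (k : fieldType) (H : quasiHopfType k).

Lemma Delta_linear : linear (@Delta k H). Proof. exact: linear_of. Qed.
Lemma eps_linear : linear (@eps k H). Proof. exact: linear_of. Qed.
Lemma antip_linear : linear (@antip k H). Proof. exact: linear_of. Qed.

End QuasiHopfLinearity.

Section QuasiHopfQuotient.
Context (k : fieldType) (H : quasiHopfType k) (I : qhideal H).

Let IP := qhidealP I.

Definition qhideal_subsp : subsp H := Subsp (qhi_subspace IP).
Definition quo := qmod qhideal_subsp.
HB.instance Definition _ := GRing.Lmodule.on quo.

Definition quoproj : H -> quo := @qproj k H qhideal_subsp.
Local Notation q := quoproj.

Lemma quoproj_linear : linear q.
Proof. exact: (@qproj_linear k H qhideal_subsp). Qed.
HB.instance Definition _ := GRing.isLinear.Build k H quo _ quoproj quoproj_linear.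

Lemma quoD x y : q (x + y) = q x + q y.
Proof. exact: (linD quoproj_linear). Qed.

Lemma quoZ a x : q (a *: x) = a *: q x.
Proof. exact: (linZ quoproj_linear). Qed.

Lemma quoprojK (x : quo) : q (repr x) = x.
Proof. exact: (@qprojK k H qhideal_subsp). Qed.

Lemma quoproj_eq x y : q x = q y <-> qhideal_set I (x - y).
Proof. exact: (@qproj_eq k H qhideal_subsp). Qed.

Lemma quoproj_eq0 x : q x = 0 <-> qhideal_set I x.
Proof. exact: (@qproj_eq0 k H qhideal_subsp). Qed.

Lemma quo_descend (W : lmodType k) (f : H -> W) : linear f ->
  (forall x, qhideal_set I x -> f x = 0) -> forall x, f (repr (q x)) = f x.
Proof.
move=> hf h x; apply/eqP; rewrite -subr_eq0 -(linB hf); apply/eqP/h.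
by apply/quoproj_eq; rewrite quoprojK.
Qed.

Definition quomul (x y : quo) : quo := q (repr x * repr y).

Lemma quomulE x y : quomul (q x) (q y) = q (x * y).
Proof.
rewrite /quomul.
rewrite (@quo_descend _ (fun z => q (z * repr (q y)))).
- rewrite (@quo_descend _ (fun z => q (x * z))) //.
    exact: linear_comp quoproj_linear (mulr_linear_r x).
  by move=> z Iz; apply/quoproj_eq0/(qhi_mull IP).
- exact: linear_comp quoproj_linear (mulr_linear_l _).
- by move=> z Iz; apply/quoproj_eq0/(qhi_mulr IP).
Qed.

Lemma quomulA : associative quomul.
Proof.
move=> x y z; rewrite -(quoprojK x) -(quoprojK y) -(quoprojK z).
by rewrite !quomulE mulrA.
Qed.

Lemma quomul1 : left_id (q 1) quomul.
Proof. by move=> x; rewrite -(quoprojK x) quomulE mul1r. Qed.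

Lemma quomulr1 : right_id (q 1) quomul.
Proof. by move=> x; rewrite -(quoprojK x) quomulE mulr1. Qed.

Lemma quomulDl : left_distributive quomul +%R.
Proof.
move=> x y z; rewrite -(quoprojK x) -(quoprojK y) -(quoprojK z).
by rewrite -quoD !quomulE -quoD mulrDl.
Qed.

Lemma quomulDr : right_distributive quomul +%R.
Proof.
move=> x y z; rewrite -(quoprojK x) -(quoprojK y) -(quoprojK z).
by rewrite -quoD !quomulE -quoD mulrDr.
Qed.

Lemma quo1_neq0 : q 1 != 0.
Proof.
apply/eqP => /quoproj_eq0 /(qhi_eps IP); rewrite rmorph1 => /eqP.
by rewrite oner_eq0.
Qed.

HB.instance Definition _ := GRing.Zmodule_isNzRing.Build quo
  quomulA quomul1 quomulr1 quomulDl quomulDr quo1_neq0.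

Lemma quoproj_monoid : monoid_morphism q.
Proof. by split=> // x y; rewrite [RHS]quomulE. Qed.
HB.instance Definition _ := GRing.isMonoidMorphism.Build H quo quoproj quoproj_monoid.

Lemma quoM x y : q (x * y) = q x * q y.
Proof. exact: quoproj_monoid.2. Qed.

Lemma quoscaleAl a (x y : quo) : a *: (x * y) = (a *: x) * y.
Proof.
rewrite -(quoprojK x) -(quoprojK y).
by rewrite -quoZ -!quoM -quoZ scalerAl.
Qed.

HB.instance Definition _ := GRing.Lmodule_isLalgebra.Build k quo quoscaleAl.

Lemma quoscaleAr a (x y : quo) : a *: (x * y) = x * (a *: y).
Proof.
rewrite -(quoprojK x) -(quoprojK y).
by rewrite -quoZ -!quoM -quoZ scalerAr.
Qed.

HB.instance Definition _ := GRing.Lalgebra_isAlgebra.Build k quo quoscaleAr.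

Let ql := quoproj_linear.
Let qm := quoproj_monoid.

Definition quo2 : H \ox H -> quo \ox quo := tmap q q.
Definition quo3 : H \ox H \ox H -> quo \ox quo \ox quo := tmap quo2 q.
Definition quo4 : H \ox H \ox H \ox H -> quo \ox quo \ox quo \ox quo := tmap quo3 q.

Lemma quo2_linear : linear quo2. Proof. exact: tmap_linear. Qed.
Lemma quo3_linear : linear quo3. Proof. exact: tmap_linear quo2_linear ql. Qed.
Lemma quo4_linear : linear quo4. Proof. exact: tmap_linear quo3_linear ql. Qed.
Lemma quo2_monoid : monoid_morphism quo2. Proof. exact: tmap_monoid. Qed.
Lemma quo3_monoid : monoid_morphism quo3.
Proof. exact: tmap_monoid quo2_linear ql quo2_monoid qm. Qed.
Lemma quo4_monoid : monoid_morphism quo4.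
Proof. exact: tmap_monoid quo3_linear ql quo3_monoid qm. Qed.

Definition quoDelta (x : quo) : quo \ox quo := quo2 (Delta (repr x)).
Definition quoeps (x : quo) : k^o := eps (repr x).
Definition quoantip (x : quo) : quo := q (antip (repr x)).

Lemma quoDeltaE x : quoDelta (q x) = quo2 (Delta x).
Proof.
apply: (@quo_descend _ (fun x => quo2 (Delta x))).
  by move=> a y z; rewrite Delta_linear quo2_linear.
move=> y Iy; have [s hs [t ht <-]] := qhi_Delta IP Iy.
rewrite (linD quo2_linear).
have k0 : subspace (quo2 @^-1` [set 0]).
  by apply: preim_subspace; [exact: quo2_linear|exact: subspace_set0].
have -> : quo2 s = 0.
  apply: (lspan_sub k0 _ hs) => _ [a Ia [b _ <-]]; rewrite /preimage /= /quo2.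
  rewrite tmapE //; have -> : q a = 0 by apply/quoproj_eq0.
  exact: (lin0 ((tpure_bilin _ _).1 _)).
have -> : quo2 t = 0; last by rewrite addr0.
apply: (lspan_sub k0 _ ht) => _ [a _ [b Ib <-]]; rewrite /preimage /= /quo2.
rewrite tmapE //; have -> : q b = 0 by apply/quoproj_eq0.
exact: (lin0 ((tpure_bilin _ _).2 _)).
Qed.

Lemma quoepsE x : quoeps (q x) = eps x.
Proof. exact: (quo_descend (@eps_linear k H) (qhi_eps IP)). Qed.

Lemma quoantipE x : quoantip (q x) = q (antip x).
Proof.
apply: (@quo_descend _ (fun x => q (antip x))).
  by move=> a y z; rewrite antip_linear ql.
by move=> y Iy; apply/quoproj_eq0/(qhi_antip IP).
Qed.

Lemma quoDelta_linear : linear quoDelta.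
Proof.
move=> a x y; rewrite -(quoprojK x) -(quoprojK y) -ql !quoDeltaE.
by rewrite Delta_linear quo2_linear.
Qed.

Lemma quoeps_linear : linear quoeps.
Proof.
move=> a x y; rewrite -(quoprojK x) -(quoprojK y) -ql !quoepsE.
exact: eps_linear.
Qed.

Lemma quoantip_linear : linear quoantip.
Proof.
move=> a x y; rewrite -(quoprojK x) -(quoprojK y) -ql !quoantipE.
by rewrite antip_linear ql.
Qed.

Lemma quoDelta_monoid : monoid_morphism quoDelta.
Proof.
split; first by rewrite [1]/(q 1) quoDeltaE rmorph1 quo2_monoid.1.
move=> x y; rewrite -(quoprojK x) -(quoprojK y) -quoM !quoDeltaE rmorphM.
exact: quo2_monoid.2.
Qed.

Lemma quoeps_monoid : monoid_morphism quoeps.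
Proof.
split; first by rewrite [1]/(q 1) quoepsE rmorph1.
by move=> x y; rewrite -(quoprojK x) -(quoprojK y) -quoM !quoepsE rmorphM.
Qed.

HB.instance Definition _ := GRing.isLinear.Build k quo (quo \ox quo)%type _
  quoDelta quoDelta_linear.
HB.instance Definition _ := GRing.isMonoidMorphism.Build quo (quo \ox quo)%type
  quoDelta quoDelta_monoid.
HB.instance Definition _ := GRing.isLinear.Build k quo k^o _ quoeps quoeps_linear.
HB.instance Definition _ := GRing.isMonoidMorphism.Build quo k^o quoeps quoeps_monoid.
HB.instance Definition _ := GRing.isLinear.Build k quo quo _ quoantip quoantip_linear.

Definition quoPhi := quo3 (@Phi k H).
Definition quoPhiI := quo3 (@PhiI k H).
Definition quoalpha := q (@alpha k H).
Definition quobeta := q (@beta k H).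

Lemma quoPhiK : quoPhi * quoPhiI = 1.
Proof. exact: (monoid_eq21 quo3_monoid (@PhiK k H)). Qed.

Lemma quoPhiIK : quoPhiI * quoPhi = 1.
Proof. exact: (monoid_eq21 quo3_monoid (@PhiIK k H)). Qed.

Lemma quoantip1 : quoantip 1 = 1.
Proof. by rewrite [1]/(q 1) quoantipE antip1. Qed.

Lemma quoantipM x y : quoantip (x * y) = quoantip y * quoantip x.
Proof.
by rewrite -(quoprojK x) -(quoprojK y) -quoM !quoantipE antipM quoM.
Qed.

Lemma quo_idDelta (U U' : algType k) (f : U -> U') t : linear f ->
  tmap idfun quoDelta (tmap f q t) = tmap f quo2 (tmap idfun Delta t).
Proof.
move=> hf; have hid := @linear_id k.
rewrite (tmap_comp _ _ _ (hid _) quoDelta_linear) (tmap_comp _ _ _ hf quo2_linear).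
by apply: eq_tmap => x; [|exact: quoDeltaE].
Qed.

Lemma quo_Deltaid (U U' : algType k) (f : U -> U') t : linear f ->
  tmap quoDelta idfun (tmap q f t) = tmap quo2 f (tmap Delta idfun t).
Proof.
move=> hf; have hid := @linear_id k.
rewrite (tmap_comp _ _ _ quoDelta_linear (hid _)) (tmap_comp _ _ _ quo2_linear hf).
by apply: eq_tmap => x; [exact: quoDeltaE|].
Qed.

Lemma quo_assoc3 t : tassoc (tmap q quo2 t) = quo3 (tassoc t).
Proof. exact: tassoc_tmap. Qed.

Lemma quo_pentagon :
  tmap (@tassoc k quo quo quo) idfun (tassoc (1 \ox quoPhi))
    * tmap (@tassoc k quo quo quo \o tmap idfun quoDelta) idfun quoPhi
    * (quoPhi \ox 1)
  = tassoc (tmap idfun quoDelta quoPhi) * tmap (tmap quoDelta idfun) idfun quoPhi.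
Proof.
have hid := @linear_id k.
have DL := quoDelta_linear.
have E1 : tmap (@tassoc k quo quo quo) idfun (tassoc (1 \ox quoPhi))
    = quo4 (tmap (@tassoc k H H H) idfun (tassoc (1 \ox Phi))).
  have -> : 1 \ox quoPhi = tmap q quo3 (1 \ox Phi).
    by rewrite (tmapE _ _ ql quo3_linear) qm.1.
  rewrite /quo4 (tassoc_tmap _ ql quo2_linear ql).
  rewrite (tmap_comp _ _ _ (@tassoc_linear k _ _ _) (hid _)).
  rewrite (tmap_comp _ _ _ quo3_linear ql).
  by apply: eq_tmap => t; [exact: quo_assoc3|].
have E2 : tmap (@tassoc k quo quo quo \o tmap idfun quoDelta) idfun quoPhi
    = quo4 (tmap (@tassoc k H H H \o tmap idfun Delta) idfun Phi).
  rewrite /quo4 [quoPhi]/(tmap quo2 q Phi).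
  rewrite (tmap_comp _ _ _ (linear_comp (@tassoc_linear k _ _ _)
    (tmap_linear (hid _) DL)) (hid _)).
  rewrite (tmap_comp _ _ _ quo3_linear ql).
  apply: eq_tmap => t; last by [].
  rewrite [LHS]/(tassoc (tmap idfun quoDelta (tmap q q t))) (quo_idDelta _ ql).
  exact: quo_assoc3.
have E3 : quoPhi \ox 1 = quo4 (Phi \ox 1).
  by rewrite /quo4 (tmapE _ _ quo3_linear ql) qm.1.
have E4 : tassoc (tmap idfun quoDelta quoPhi) = quo4 (tassoc (tmap idfun Delta Phi)).
  rewrite /quoPhi /quo3 (quo_idDelta _ quo2_linear).
  exact: (tassoc_tmap _ quo2_linear ql ql).
have E5 : tmap (tmap quoDelta idfun) idfun quoPhi = quo4 (tmap (tmap Delta idfun) idfun Phi).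
  rewrite /quo4 [quoPhi]/(tmap quo2 q Phi).
  rewrite (tmap_comp _ _ _ (tmap_linear DL (hid _)) (hid _)).
  rewrite (tmap_comp _ _ _ quo3_linear ql).
  by apply: eq_tmap => t; [exact: (quo_Deltaid _ ql)|].
rewrite E1 E2 E3 E4 E5; exact: (monoid_eq32 quo4_monoid (@pentagon k H)).
Qed.

Lemma quo_quasi_coassoc x :
  quoPhi * tmap quoDelta idfun (quoDelta x)
  = tassoc (tmap idfun quoDelta (quoDelta x)) * quoPhi.
Proof.
rewrite -(quoprojK x) quoDeltaE (quo_Deltaid _ ql) (quo_idDelta _ ql).
rewrite quo_assoc3; exact: (monoid_eq22 quo3_monoid (quasi_coassoc _)).
Qed.

Lemma quoepsr_bilin : bilin (fun a b : quo => (quoeps b : k) *: a).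
Proof.
split=> [b|a] c x y; first by rewrite scalerDr !scalerA mulrC.
by rewrite quoeps_linear scalerDl scalerA.
Qed.

Lemma quoepsl_bilin : bilin (fun a b : quo => (quoeps a : k) *: b).
Proof.
split=> [b|a] c x y; last by rewrite scalerDr !scalerA mulrC.
by rewrite quoeps_linear scalerDl scalerA.
Qed.

Lemma quo_epsr t : tsum (fun a b => (quoeps b : k) *: a) (quo2 t)
  = q (tsum (fun a b => (eps b : k) *: a) t).
Proof.
rewrite /quo2 tsum_tmap; last exact: quoepsr_bilin.
by rewrite (tsum_lin _ _ ql); apply: eq_tsum => a b; rewrite quoepsE -quoZ.
Qed.

Lemma quo_Phi_counit :
  tmap (tsum (fun a b => (quoeps b : k) *: a)) idfun quoPhi = 1.
Proof.
rewrite [quoPhi]/(tmap quo2 q Phi).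
rewrite (tmap_comp _ _ _ (tsum_linear quoepsr_bilin) (@linear_id k _)).
rewrite -quo2_monoid.1 -Phi_counit /quo2 (tmap_comp _ _ _ ql ql).
by apply: eq_tmap => t; [exact: quo_epsr|].
Qed.

Lemma quo_counitr x : tsum (fun a b => (quoeps b : k) *: a) (quoDelta x) = x.
Proof. by rewrite -(quoprojK x) quoDeltaE quo_epsr counitr. Qed.

Lemma quo_counitl x : tsum (fun a b => (quoeps a : k) *: b) (quoDelta x) = x.
Proof.
rewrite -(quoprojK x) quoDeltaE /quo2 tsum_tmap; last exact: quoepsl_bilin.
rewrite -[in RHS](counitl (repr x)) (tsum_lin _ _ ql).
by apply: eq_tsum => a b; rewrite quoepsE -quoZ.
Qed.

Lemma quo_antip_alpha x :
  tsum (fun a b => quoantip a * quoalpha * b) (quoDelta x) = (quoeps x : k) *: quoalpha.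
Proof.
rewrite -(quoprojK x) quoDeltaE quoepsE -quoZ -antip_alpha /quo2 tsum_tmap.
  by rewrite (tsum_lin _ _ ql); apply: eq_tsum => a b; rewrite quoantipE !quoM.
split=> [b|a] c y z; last by rewrite mulrDr -scalerAr.
by rewrite quoantip_linear !mulrDl -!scalerAl.
Qed.

Lemma quo_antip_beta x :
  tsum (fun a b => a * quobeta * quoantip b) (quoDelta x) = (quoeps x : k) *: quobeta.
Proof.
rewrite -(quoprojK x) quoDeltaE quoepsE -quoZ -antip_beta /quo2 tsum_tmap.
  by rewrite (tsum_lin _ _ ql); apply: eq_tsum => a b; rewrite quoantipE !quoM.
split=> [b|a] c y z; first by rewrite !mulrDl -!scalerAl.
by rewrite quoantip_linear !mulrDr -!scalerAr.
Qed.

Lemma quo_antip_Phi :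
  tsum (fun t c => tsum (fun a b => a * quobeta * quoantip b * quoalpha * c) t) quoPhi = 1.
Proof.
have b1 c : bilin (fun a b => a * quobeta * quoantip b * quoalpha * c).
  split=> [b|a] d y z; first by rewrite !mulrDl -!scalerAl.
  by rewrite quoantip_linear !mulrDr !mulrDl -!scalerAr -!scalerAl.
rewrite /quoPhi /quo3 tsum_tmap; last first.
  apply: (@bilin_tsum_l k _ _ _ _ (fun a b c => a * quobeta * quoantip b * quoalpha * c)) => //.
  by move=> a b d y z; rewrite mulrDr -scalerAr.
rewrite -[RHS]qm.1 -(@antip_Phi k H) (tsum_lin _ _ ql).
apply: eq_tsum => t c.
rewrite /quo2 (tsum_tmap _ _ _ (b1 _)) (tsum_lin _ _ ql).
by apply: eq_tsum => a b; rewrite quoantipE !quoM.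
Qed.

Lemma quo_antip_PhiI :
  tsum (fun t c => tsum (fun a b => quoantip a * quoalpha * b * quobeta * quoantip c) t)
    quoPhiI = 1.
Proof.
have b1 c : bilin (fun a b => quoantip a * quoalpha * b * quobeta * quoantip c).
  split=> [b|a] d y z; first by rewrite quoantip_linear !mulrDl -!scalerAl.
  by rewrite !mulrDr !mulrDl -!scalerAr -!scalerAl.
rewrite /quoPhiI /quo3 tsum_tmap; last first.
  apply: (@bilin_tsum_l k _ _ _ _
    (fun a b c => quoantip a * quoalpha * b * quobeta * quoantip c)) => //.
  by move=> a b d y z; rewrite quoantip_linear mulrDr -scalerAr.
rewrite -[RHS]qm.1 -(@antip_PhiI k H) (tsum_lin _ _ ql).
apply: eq_tsum => t c.
rewrite /quo2 (tsum_tmap _ _ _ (b1 _)) (tsum_lin _ _ ql).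
by apply: eq_tsum => a b; rewrite !quoantipE !quoM.
Qed.

Lemma quo_eps_alpha : quoeps quoalpha = 1.
Proof. by rewrite quoepsE eps_alpha. Qed.

Lemma quo_eps_beta : quoeps quobeta = 1.
Proof. by rewrite quoepsE eps_beta. Qed.

Definition quoH : quasiHopfType k := @QuasiHopf k quo quoDelta quoeps quoPhi quoPhiI
  quoantip quoalpha quobeta quoPhiK quoPhiIK quoantip1 quoantipM quo_pentagon
  quo_quasi_coassoc quo_Phi_counit quo_counitr quo_counitl quo_antip_alpha quo_antip_beta
  quo_antip_Phi quo_antip_PhiI quo_eps_alpha quo_eps_beta.

End QuasiHopfQuotient.

Lemma prodset_subspace (k : fieldType) (A : algType k) (U V : set A) :
  subspace (prodset U V).
Proof. exact: lspan_subspace. Qed.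

Lemma prodset_mem (k : fieldType) (A : algType k) (U V : set A) u v :
  U u -> V v -> prodset U V (u * v).
Proof. by move=> hu hv; apply: sub_lspan; exists u => //; exists v. Qed.

(* The direct sum decomposition says that every [x] is [\sum_g D@_g] for a unique
   finitely supported family [D] of homogeneous elements. *)
Record qhGrading (G : groupType) (k : fieldType) (H : quasiHopfType k) := QHGrading {
  homog :> G -> set H;
  homog_subspace : forall g, subspace (homog g);
  homog_decomp : forall x, exists! D : {malg H[G]},
    (forall g, homog g D@_g) /\ x = \sum_(g <- msupp D) D@_g;
  homogM : forall g h x y, homog g x -> homog h y -> homog (g * h)%g (x * y);
  homog_Delta : forall g x, homog g x -> ttens (homog g) (homog g) (Delta x);
  homog_antip : forall g x, homog g x -> homog (g^-1)%g (antip x);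
  homog_Phi : ttens (ttens (homog 1%g) (homog 1%g)) (homog 1%g) Phi;
  homog_alpha : homog 1%g alpha;
  homog_beta : homog 1%g beta }.

Section Graded.
Context (G : groupType) (k : fieldType) (H : quasiHopfType k) (gr : qhGrading G H).
Implicit Types (N : set G) (I J : set H).

Definition faithfully_graded : Prop := forall g, gr g <> [set 0].

(* The group algebra of [G] is the space of formal sums [{malg k[G]}], whose basis
   vector at [g] is [<< g >>]. *)
Definition grmap (x : H) : {malg k[G]} :=
  let D := sval (cid (homog_decomp gr x)) in
  \sum_(g <- msupp D) << (eps D@_g : k) *g g >>.

Definition augideal N : set {malg k[G]} := lspan [set << n >> - << 1%g >> | n in N].

Definition normal_subgroup N : Prop :=
  [/\ N 1%g, forall x y, N x -> N y -> N (x * y)%g, forall x, N x -> N (x^-1)%g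
    & forall x g, N x -> N (x ^ g)%g].

Definition Hcoset N (g : G) : set H := lspan (\bigcup_(n in N) gr (g * n)%g).

Definition Hsub N : set H := Hcoset N 1%g.

(* The normal subgroup [N_I] such that [pi(I)] is [a_N_I k[G]]. *)
Definition Nideal I : set G := [set g | (grmap @` I) (<< g >> - << 1%g >>)].

Definition ginvariant J : Prop := forall g, prodset (gr g) J = prodset J (gr g).

Lemma homog_sum x : exists2 D : {malg H[G]}, (forall g, gr g D@_g)
  & x = \sum_(g <- msupp D) D@_g.
Proof. by have [D [[h1 h2] _]] := homog_decomp gr x; exists D. Qed.

Lemma homog_ind (P : set H) : subspace P -> (forall g x, gr g x -> P x) -> forall x, P x.
Proof.
move=> hP h x; have [D hD ->] := homog_sum x.
by apply: subspace_sum => // g _; apply: h (hD g).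
Qed.

Lemma grmap_decomp (D : {malg H[G]}) : (forall g, gr g D@_g) ->
  grmap (\sum_(g <- msupp D) D@_g) = \sum_(g <- msupp D) << (eps D@_g : k) *g g >>.
Proof.
move=> hD; rewrite /grmap; case: cid => E /= [_ uE].
by rewrite (uE D).
Qed.

Lemma msupp_sumEw (W : lmodType k) (F : G -> H -> W) (D : {malg H[G]}) (E : {fset G}) :
  (forall g, F g 0 = 0) -> (msupp D `<=` E)%fset ->
  \sum_(g <- msupp D) F g D@_g = \sum_(g <- E) F g D@_g.
Proof.
move=> F0 DE; rewrite (big_fset_incl _ DE) // => g _.
by move=> /mcoeff_outdom ->.
Qed.

Lemma grmap_linear : linear grmap.
Proof.
move=> a x y; have [D hD ->] := homog_sum x; have [E hE ->] := homog_sum y.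
pose T := (msupp D `|` msupp E)%fset.
pose B := \sum_(g <- T) << a *: D@_g + E@_g *g g >> : {malg H[G]}.
have BE g : B@_g = a *: D@_g + E@_g.
  rewrite /B raddf_sum /=; have [gT|gT] := boolP (g \in T).
    rewrite (big_fsetD1 g gT) /= mcoeffUU big_seq big1 ?addr0 // => h.
    by rewrite !inE mcoeffU => /andP[/negPf -> _].
  move: (gT); rewrite !inE negb_or => /andP[/mcoeff_outdom -> /mcoeff_outdom ->].
  rewrite scaler0 addr0 big_seq big1 // => h hT; rewrite mcoeffU.
  by case: eqP => // hg; rewrite -hg hT in gT.
have BT : (msupp B `<=` T)%fset.
  apply/fsubsetP => g; rewrite -mcoeff_neq0 BE; apply: contraNT => gT.
  move: (gT); rewrite !inE negb_or => /andP[/mcoeff_outdom -> /mcoeff_outdom ->].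
  by rewrite scaler0 addr0.
have DT : (msupp D `<=` T)%fset by apply: fsubsetUl.
have ET : (msupp E `<=` T)%fset by apply: fsubsetUr.
have hB g : gr g B@_g.
  by rewrite BE; apply: (homog_subspace gr g).2.
have -> : a *: (\sum_(g <- msupp D) D@_g) + \sum_(g <- msupp E) E@_g
    = \sum_(g <- msupp B) B@_g.
  rewrite (@msupp_sumEw H (fun _ x => x) D T) //.
  rewrite (@msupp_sumEw H (fun _ x => x) E T) //.
  rewrite (@msupp_sumEw H (fun _ x => x) B T) //.
  by rewrite scaler_sumr -big_split; apply: eq_bigr => g _; rewrite BE.
rewrite !grmap_decomp //.
pose F g (x : H) : {malg k[G]} := << (eps x : k) *g g >>.
have F0 g : F g 0 = 0 by rewrite /F raddf0 monalgU0.
rewrite (@msupp_sumEw _ F D T) // (@msupp_sumEw _ F E T) // (@msupp_sumEw _ F B T) //.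
rewrite scaler_sumr -big_split; apply: eq_bigr => g _; rewrite /F BE linearP.
apply/malgP => h; rewrite mcoeffD mcoeffZ !mcoeffU.
by case: (g == h); rewrite ?mulr1n // !mulr0n mulr0 addr0.
Qed.

Lemma grmap_homog g x : gr g x -> grmap x = << (eps x : k) *g g >>.
Proof.
move=> gx; pose D : {malg H[G]} := << x *g g >>.
have hD h : gr h D@_h.
  rewrite mcoeffU; case: eqP => [<- //|_]; rewrite mulr0n.
  by case: (homog_subspace gr h).
have sD (W : lmodType k) (F : G -> H -> W) : (forall g, F g 0 = 0) ->
    \sum_(h <- msupp D) F h D@_h = F g x.
  move=> F0; rewrite (@msupp_sumEw _ F D [fset g]%fset) ?msuppU_le //.
  by rewrite big_seq_fset1 mcoeffUU.
rewrite -{1}(sD H (fun _ x => x)) // grmap_decomp //.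
rewrite (sD _ (fun g x => << (eps x : k) *g g >>)) // => h.
by rewrite raddf0 monalgU0.
Qed.

Lemma prodset_mulr J x y : ginvariant J ->
  prodset [set: H] J x -> prodset [set: H] J (x * y).
Proof.
move=> hJ hx; move: y; apply: homog_ind.
  by have h0 := preim_subspace (mulr_linear_r x) (prodset_subspace [set: H] J); exact h0.
move=> g y gy; move: x hx; apply: lspan_sub.
  by have h0 := preim_subspace (mulr_linear_l y) (prodset_subspace [set: H] J); exact h0.
move=> _ [h _ [j Jj <-]]; rewrite /preimage /= -mulrA.
have := prodset_mem Jj gy; rewrite -hJ; move: (j * y).
apply: lspan_sub.
  by have h0 := preim_subspace (mulr_linear_r h) (prodset_subspace [set: H] J); exact h0.
move=> _ [a _ [b Jb <-]]; rewrite /preimage /= mulrA.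
exact: prodset_mem.
Qed.

Lemma lifted_qh_ideal J : qh_ideal (gr 1%g) J -> ginvariant J ->
  qh_ideal [set: H] (prodset [set: H] J).
Proof.
move=> hJ iJ; have sJ := prodset_subspace [set: H] J.
have lJ (V : lmodType k) (f : H -> V) (W : set V) : subspace W -> linear f ->
    (forall h j, J j -> W (f (h * j))) -> forall x, prodset [set: H] J x -> W (f x).
  move=> hW hf h; apply: lspan_sub (preim_subspace hf hW) _.
  by move=> _ [a _ [b Jb <-]]; apply: h.
split=> //.
- move=> a x _ hx; apply: (lJ _ (fun z => a * z) _ sJ (mulr_linear_r a) _ x hx) => h j Jj.
  by rewrite mulrA; apply: prodset_mem.
- by move=> a x _; apply: prodset_mulr.
- set P1 := ttens (prodset _ _) _; set P2 := ttens _ (prodset _ _).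
  have s1 : subspace P1 by exact: lspan_subspace.
  have s2 : subspace P2 by exact: lspan_subspace.
  have s12 : subspace [set s + t | s in P1 & t in P2].
    split; first by exists 0; [case: s1|exists 0; [case: s2|rewrite addr0]].
    move=> a _ _ [s hs [t ht <-]] [s' hs' [t' ht' <-]].
    exists (a *: s + s'); first exact: s1.2.
    exists (a *: t + t'); first exact: s2.2.
    by rewrite scalerDr addrACA.
  move=> x hx; apply: (lJ _ _ _ s12 (@Delta_linear k H) _ x hx) => h j Jj.
  have -> : Delta (h * j) = Delta h * Delta j by rewrite rmorphM.
  have [s hs [t ht <-]] := qhi_Delta hJ Jj; rewrite mulrDr.
  exists (Delta h * s).
    move: (Delta h) => d; move: s hs; apply: lspan_sub.
      by have h0 := preim_subspace (mulr_linear_r d) s1; exact h0.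
    move=> _ [a Ja [b _ <-]]; rewrite /preimage /=; move: d; apply: tensor_ind.
      by have h0 := preim_subspace (mulr_linear_l (a \ox b)) s1; exact h0.
    move=> u v; rewrite /preimage /= tmulrE; apply: sub_lspan.
    by exists (u * a); [apply: prodset_mem|exists (v * b)].
  exists (Delta h * t) => //.
  move: (Delta h) => d; move: t ht; apply: lspan_sub.
    by have h0 := preim_subspace (mulr_linear_r d) s2; exact h0.
  move=> _ [a _ [b Jb <-]]; rewrite /preimage /=; move: d; apply: tensor_ind.
    by have h0 := preim_subspace (mulr_linear_l (a \ox b)) s2; exact h0.
  move=> u v; rewrite /preimage /= tmulrE; apply: sub_lspan.
  by exists (u * a) => //; exists (v * b) => //; apply: prodset_mem.
- move=> x hx; apply: (lJ _ _ [set 0] (subspace_set0 _) (@eps_linear k H) _ x hx) => h j Jj.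
  have -> : eps (h * j) = eps h * eps j by rewrite rmorphM.
  by rewrite (qhi_eps hJ Jj) mulr0.
- move=> x hx; apply: (lJ _ _ _ sJ (@antip_linear k H) _ x hx) => h j Jj; rewrite antipM; apply: prodset_mulr => //.
  rewrite -[antip j]mul1r; apply: prodset_mem => //.
  exact: (qhi_antip hJ).
Qed.

Lemma zero_qh_ideal : qh_ideal [set: H] [set 0].
Proof.
split=> //.
- exact: subspace_set0.
- by move=> a x _ /= ->; rewrite mulr0.
- by move=> a x _ /= ->; rewrite mul0r.
- move=> _ -> /=; rewrite raddf0; have z A B : ttens A B (0 : H \ox H).
    by case: (lspan_subspace [set u \ox v | u in A & v in B]).
  by exists 0 => //; exists 0 => //; rewrite addr0.
- by move=> _ -> /=; rewrite raddf0.
- by move=> _ -> /=; rewrite raddf0.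
Qed.

(* The lifted ideal [H J] of a [G]-invariant quasi-Hopf ideal [J] of [H_e]; the junk
   value for other sets [J] is the zero ideal. *)
Definition lifted J : qhideal H :=
  match pselect (qh_ideal (gr 1%g) J /\ ginvariant J) with
  | left p => QHIdealPack (lifted_qh_ideal p.1 p.2)
  | right _ => QHIdealPack zero_qh_ideal
  end.

Lemma liftedE J : qh_ideal (gr 1%g) J -> ginvariant J ->
  lifted J = prodset [set: H] J :> set H.
Proof. by move=> h1 h2; rewrite /lifted; case: pselect => // -[]. Qed.

Definition lquo J : quasiHopfType k := quoH (lifted J).

Definition lproj J : H -> lquo J := quoproj (lifted J).

(* [H_N / J^N] is the image [lproj J @` Hsub N] of [H_N] in [H / J^G], and its
   grading map is the restriction to it of the following one. *)
Definition lgrmap J (y : lquo J) : {malg k[G]} := grmap (repr (y : quo (lifted J))).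

Lemma lgrmapE J x : lgrmap (lproj J x) = grmap x.
Proof.
apply: (quo_descend grmap_linear) => {}x; rewrite /lifted; case: pselect => /=; last first.
  by move=> _ ->; rewrite (lin0 grmap_linear).
move=> [hJ iJ]; move: x; apply: (@lspan_sub _ _ _ (grmap @^-1` [set 0])).
  by have h0 := preim_subspace grmap_linear (subspace_set0 _); exact h0.
move=> _ [h _ [j Jj <-]]; move: h; apply: homog_ind.
  apply: (preim_subspace _ (subspace_set0 _)).
  exact: linear_comp grmap_linear (mulr_linear_l j).
move=> g x gx; rewrite /preimage /=.
have gxj : gr (g * 1)%g (x * j) by apply: homogM => //; apply: (qhi_sub hJ).
have epsM : eps (x * j) = eps x * eps j by rewrite rmorphM.
by rewrite (grmap_homog gxj) epsM (qhi_eps hJ Jj) mulr0 monalgU0.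
Qed.

Record datum := Datum {
  dN : set G;
  dJ : set H;
  dL : set (lquo dJ) }.
Arguments dL : clear implicits.

Record reduced_admissible (d : datum) : Prop := ReducedAdmissible {
  ra_normal : normal_subgroup (dN d);
  ra_ideal : qh_ideal (gr 1%g) (dJ d);
  ra_invariant : ginvariant (dJ d);
  ra_qh_ideal : qh_ideal (lproj (dJ d) @` Hsub (dN d)) (dL d);
  ra_trivial : dL d `&` (lproj (dJ d) @` gr 1%g) = [set 0];
  ra_aug : augideal (dN d) `<=` lgrmap (J := dJ d) @` dL d;
  ra_commute : forall g, prodset (lproj (dJ d) @` Hcoset (dN d) g) (dL d)
                       = prodset (dL d) (lproj (dJ d) @` Hcoset (dN d) g) }.

Definition datum_of_ideal I : datum :=
  @Datum (Nideal I) (I `&` gr 1%g) (lproj (I `&` gr 1%g) @` (I `&` Hsub (Nideal I))).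

Definition Kpreim (d : datum) : set H :=
  Hsub (dN d) `&` (lproj (dJ d) @^-1` dL d).

(* The sum over [G / N] is indexed by all coset representatives [g]. *)
Definition ideal_of_datum (d : datum) : set H :=
  lspan (\bigcup_(g in [set: G]) prodset (Hcoset (dN d) g) (Kpreim d)).

End Graded.

(* Main.v *)
Require Import Defs.
From mathcomp Require Import all_boot all_order all_algebra.
From mathcomp Require Import boolp classical_sets.
From mathcomp Require Import finmap monalg.

(* For an ideal [I], the functions [psi : G -> k] whose linear extensions to [k[G]]
   vanish on [pi(I)] form a translation-invariant algebra, because [x_g |-> psi(g) x_g]
   is [(id \ox (psi o pi)) Delta] and hence preserves [I]. This algebra takes equal values
   at two points exactly when they lie in the same coset of [N_I], so by interpolation it
   contains, on any finite set, the indicator of a coset. Therefore [I] is the sum of its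
   coset components. Since [1] lies in [H_g H_(g^-1)] (faithful gradings are strong),
   these components are recovered from [I `&` H_N]. Conversely [H K_L] meets [H_N] in
   [K_L], and [K_L] determines [L], and [J] by the triviality condition. *)

Set Implicit Arguments.
Unset Strict Implicit.
Unset Printing Implicit Defensive.

Import GRing.Theory.
Local Open Scope classical_set_scope.
Local Open Scope ring_scope.

(** * Complements and projections for subspaces of arbitrary dimension *)

Section SubspaceComplements.
Context (k : fieldType) (V : lmodType k).
Implicit Types A B I W : set V.

Lemma sumset_subspace A B : subspace A -> subspace B ->
  subspace [set s + t | s in A & t in B].
Proof.
move=> [A0 hA] [B0 hB]; split; first by exists 0 => //; exists 0 => //; rewrite addr0.
move=> a _ _ [s As [t Bt <-]] [s' As' [t' Bt' <-]].
exists (a *: s + s'); first exact: hA.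
by exists (a *: t + t'); [exact: hB|rewrite scalerDr addrACA].
Qed.

Lemma subspaceI A B : subspace A -> subspace B -> subspace (A `&` B).
Proof.
move=> [A0 hA] [B0 hB]; split=> // a x y [Ax Bx] [Ay By].
by split; [exact: hA|exact: hB].
Qed.

(** By Zorn's lemma, [M] is taken maximal among the subspaces that contain [A] and meet [B]
    trivially. *)
Lemma complement_exists A B : subspace A -> subspace B ->
  (forall x, A x -> B x -> x = 0) ->
  exists M, [/\ subspace M, A `<=` M, forall x, M x -> B x -> x = 0
    & forall x, exists2 b, B b & M (x - b)].
Proof.
move=> sA sB AB.
pose good X := [/\ subspace X, A `<=` X & forall x, X x -> B x -> x = 0].
have [|M [PM maxM]] := @Zorn_bigcup V (fun X => X = set0 \/ good X).
  move=> F FP totF.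
  have FP' X x : F X -> X x -> good X.
    by move=> FX Xx; case: (FP X FX) => // XE; rewrite XE in Xx.
  have [[X [y [FX Xy]]]|nF] := pselect (exists X y, F X /\ X y); last first.
    by left; rewrite -subset0 => y [X FX Xy]; apply: nF; exists X, y.
  have [sX AX _] := FP' _ _ FX Xy; right; split.
  - split=> [|a u v [Y FY Yu] [Z FZ Zv]]; first by exists X => //; case: sX.
    have [[_ sY] _ _] := FP' _ _ FY Yu; have [[_ sZ] _ _] := FP' _ _ FZ Zv.
    by have [YZ|ZY] := totF _ _ FY FZ; [exists Z|exists Y] => //;
      [apply: sZ => //; apply: YZ|apply: sY => //; apply: ZY].
  - by move=> u Au; exists X => //; apply: AX.
  - by move=> u [Y FY Yu]; have [_ _] := FP' _ _ FY Yu; apply.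
case: PM => [M0|[sM AM MB]].
  exfalso; apply: (maxM A); last by right; split.
  by rewrite M0; split; [exact: sub0set|move=> /(_ 0 sA.1)].
exists M; split=> // x; apply: contrapT => nx.
(* [C] is [M + k x]. A point of [C] in [B] with coefficient [a] nonzero would put [x] in [M + B], so
   [C] contradicts maximality. *)
pose C := [set z | exists a, M (z - a *: x)].
have sC : subspace C.
  split; first by exists 0; rewrite scale0r subr0; case: sM.
  move=> a u v [b Mb] [c Mc]; exists (a * b + c).
  have -> : a *: u + v - (a * b + c) *: x = a *: (u - b *: x) + (v - c *: x).
    by rewrite scalerBr scalerA scalerDl opprD addrACA.
  by case: sM => _; apply.
have MC : M `<=` C by move=> z Mz; exists 0; rewrite scale0r subr0.
apply: (maxM C).
  split=> // /(_ x) CM; apply: nx; exists 0; first by case: sB.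
  by rewrite subr0; apply: CM; exists 1; rewrite scale1r subrr; case: sM.
right; split=> //; first exact: subset_trans AM MC.
move=> z [a Ma] Bz; have [a0|a0] := eqVneq a 0.
  by apply: MB => //; rewrite a0 scale0r subr0 in Ma.
case: nx; exists (a^-1 *: z); first exact: subspaceZ.
have -> : x - a^-1 *: z = - a^-1 *: (z - a *: x).
  by rewrite scalerBr !scaleNr scalerA mulVf // scale1r opprK addrC.
exact: subspaceZ.
Qed.

(** With [C] a complement of the intersection of [I] and [W], the space [W] splits as that
    intersection plus the part of [C] in [W]. This part meets [I] trivially, hence has a complement
    [M] containing [I], and [P] is the projection onto it along [M]. *)
Lemma projection_along I W : subspace I -> subspace W ->
  exists P : V -> V, [/\ linear P, forall x, I x -> P x = 0
    & forall w, W w -> W (P w) /\ (I `&` W) (w - P w)].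
Proof.
move=> sI sW; have sIW := subspaceI sI sW.
have [|C [sC _ C0 Cdec]] := complement_exists (subspace_set0 V) sIW.
  by move=> x ->.
have sCW := subspaceI sC sW.
have [|M [sM IM M0 Mdec]] := complement_exists sI sCW.
  by move=> x Ix [Cx Wx]; apply: C0.
pose P x := sval (cid2 (Mdec x)).
have PP x : (C `&` W) (P x) /\ M (x - P x) by rewrite /P; case: cid2.
have PE x c : (C `&` W) c -> M (x - c) -> P x = c.
  move=> hc Mc; have [hp Mp] := PP x; apply/eqP; rewrite -subr_eq0; apply/eqP.
  apply: M0; last exact: subspaceB.
  have -> : P x - c = (x - c) - (x - P x) by rewrite opprB [RHS]addrC addrA subrK.
  exact: subspaceB.
exists P; split=> [a x y|x Ix|w Ww].
- have [hx Mx] := PP x; have [hy My] := PP y; apply: PE; first exact: sCW.2.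
  have -> : a *: x + y - (a *: P x + P y) = a *: (x - P x) + (y - P y).
    by rewrite scalerBr opprD addrACA.
  exact: sM.2.
- by apply: PE; [case: sCW|rewrite subr0; apply: IM].
- have [c [Ic Wc] Cc] := Cdec w.
  have -> : P w = w - c.
    apply: PE; first by split=> //; apply: subspaceB.
    by rewrite subKr; apply: IM.
  by rewrite subKr; split=> //; apply: subspaceB.
Qed.

End SubspaceComplements.

(** * Tensor products of subspaces, and the subspaces [I \ox W + W \ox I] *)

Section TensorSubspaces.
Context (k : fieldType) (U V : algType k).

Lemma ttens_subspace (A : set U) (B : set V) : subspace (ttens A B).
Proof. exact: lspan_subspace. Qed.

Lemma ttens_pure (A : set U) (B : set V) u v : A u -> B v -> ttens A B (u \ox v).
Proof. by move=> Au Bv; apply: sub_lspan; exists u => //; exists v. Qed.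

Lemma ttens_sub (A : set U) (B : set V) (P : set (U \ox V)) : subspace P ->
  (forall u v, A u -> B v -> P (u \ox v)) -> ttens A B `<=` P.
Proof. by move=> sP h; apply: lspan_sub => // _ [u Au [v Bv <-]]; apply: h. Qed.

Lemma ttensS (A A' : set U) (B B' : set V) :
  A `<=` A' -> B `<=` B' -> ttens A B `<=` ttens A' B'.
Proof.
move=> hA hB; apply: ttens_sub; first exact: ttens_subspace.
by move=> u v Au Bv; apply: ttens_pure; [apply: hA|apply: hB].
Qed.

Lemma tpure0l (v : V) : (0 : U) \ox v = 0.
Proof. exact: (lin0 ((tpure_bilin _ _).1 v)). Qed.

Lemma tpure0r (u : U) : u \ox (0 : V) = 0.
Proof. exact: (lin0 ((tpure_bilin _ _).2 u)). Qed.

End TensorSubspaces.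

Section TensorIdeals.
Context (k : fieldType).

(** Spelled exactly as in [qhi_Delta], so that the two convert into each other. *)
Definition tcoideal (U : algType k) (I W : set U) : set (U \ox U) :=
  [set s + t | s in ttens I W & t in ttens W I].

Lemma tcoideal_subspace (U : algType k) (I W : set U) : subspace (tcoideal I W).
Proof. by apply: sumset_subspace; apply: ttens_subspace. Qed.

Lemma tcoideal_l (U : algType k) (I W : set U) u v : I u -> W v -> tcoideal I W (u \ox v).
Proof.
move=> Iu Wv; exists (u \ox v); first exact: ttens_pure.
by exists 0; [case: (ttens_subspace W I)|rewrite addr0].
Qed.

Lemma tcoideal_r (U : algType k) (I W : set U) u v : W u -> I v -> tcoideal I W (u \ox v).
Proof.
move=> Wu Iv; exists 0; first by case: (ttens_subspace I W).
by exists (u \ox v); [exact: ttens_pure|rewrite add0r].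
Qed.

Lemma tcoideal_sub (U : algType k) (I W : set U) (P : set (U \ox U)) : subspace P ->
  (forall u v, I u -> W v -> P (u \ox v)) ->
  (forall u v, W u -> I v -> P (u \ox v)) -> tcoideal I W `<=` P.
Proof.
move=> sP h1 h2 _ [s hs [t ht <-]].
by apply: (subspaceD sP); [apply: ttens_sub hs|apply: ttens_sub ht].
Qed.

Lemma tcoideal_mull (U : algType k) (I : set U) s t :
  (forall a x, I x -> I (a * x)) ->
  tcoideal I [set: U] t -> tcoideal I [set: U] (s * t).
Proof.
move=> mI; have S := tcoideal_subspace I [set: U].
move: t; apply: tcoideal_sub => [|u v Iu _|u v _ Iv].
- have h0 := preim_subspace (mulr_linear_r s) S; exact h0.
- move: s; apply: tensor_ind => [|a b].
    have h0 := preim_subspace (mulr_linear_l (u \ox v)) S; exact h0.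
  by rewrite /= tmulrE; apply: tcoideal_l; first exact: mI.
- move: s; apply: tensor_ind => [|a b].
    have h0 := preim_subspace (mulr_linear_l (u \ox v)) S; exact h0.
  by rewrite /= tmulrE; apply: tcoideal_r; last exact: mI.
Qed.

(** Since [u \ox v - P u \ox P v = (u - P u) \ox v + P u \ox (v - P v)], the map [P \ox P] is the
    identity on [W \ox W] modulo [tcoideal I W]. *)
Lemma tmap_ker_tcoideal (U : algType k) (P : U -> U) (I W : set U) t : linear P ->
  (forall w, W w -> W (P w) /\ I (w - P w)) ->
  ttens W W t -> tmap P P t = 0 -> tcoideal I W t.
Proof.
move=> lP hP hW Pt0; rewrite -[t]subr0 -Pt0; have sIW := tcoideal_subspace I W.
move: t hW {Pt0}; apply: ttens_sub.
  split; first by rewrite /= (lin0 (tmap_linear lP lP)) subr0; case: sIW.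
  move=> a x y hx hy /=.
  have -> : a *: x + y - tmap P P (a *: x + y)
      = a *: (x - tmap P P x) + (y - tmap P P y).
    by rewrite (tmap_linear lP lP a x y) scalerBr opprD addrACA.
  exact: sIW.2 a _ _ hx hy.
move=> u v Wu Wv; rewrite tmapE //.
have -> : u \ox v - P u \ox P v = (u - P u) \ox v + P u \ox (v - P v).
  by rewrite (linB ((tpure_bilin _ _).1 v)) (linB ((tpure_bilin _ _).2 (P u))) addrA subrK.
have [WPu Iu] := hP _ Wu; have [WPv Iv] := hP _ Wv.
by apply: subspaceD => //; [apply: tcoideal_l|apply: tcoideal_r].
Qed.

(** The projection [P] of [projection_along] kills [I], so [P \ox P] kills [tcoideal I [set: U]],
    while on [W] it moves points only by elements of [I] lying in [W]. This gives the coideal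
    condition for intersections with graded pieces. *)
Lemma tcoidealI (U : algType k) (I W : set U) : subspace I -> subspace W ->
  tcoideal I [set: U] `&` ttens W W `<=` tcoideal (I `&` W) W.
Proof.
move=> sI sW t [It Wt]; have [P [lP P0 PW]] := projection_along sI sW.
apply: (tmap_ker_tcoideal lP PW Wt).
have lPP := tmap_linear lP lP.
apply: (@tcoideal_sub U I [set: U] (tmap P P @^-1` [set 0])) It => [|u v Iu _|u v _ Iv].
- by have h0 := preim_subspace lPP (subspace_set0 _); exact h0.
- by rewrite /= tmapE // (P0 u) // tpure0l.
- by rewrite /= tmapE // (P0 v) // tpure0r.
Qed.

(** A projection [P] that kills [I] and moves points only by elements of [I] factors through the
    quotient, so [P \ox P] vanishes wherever the tensor square of the quotient map does. *)
Lemma quo2_ker (H : quasiHopfType k) (I : qhideal H) t :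
  quo2 I t = 0 -> tcoideal I [set: H] t.
Proof.
have sI := qhi_subspace (qhidealP I).
move=> t0; have [P [lP P0 PW]] := projection_along sI (subspace_setT H).
have ht : ttens [set: H] [set: H] t.
  by move: t {t0}; apply: tensor_ind; [exact: ttens_subspace|move=> u v; apply: ttens_pure].
apply: (tmap_ker_tcoideal lP _ ht) => [w _|].
  by have [_ []] := PW w Logic.I.
have lq := quoproj_linear I.
pose P' (x : quo I) : H := P (repr x).
have P'E x : P' (quoproj I x) = P x := quo_descend lP P0 x.
have lP' : linear P'.
  by move=> a x y; rewrite -(quoprojK x) -(quoprojK y) -lq !P'E lP.
rewrite (@eq_tmap _ _ _ _ _ P (P' \o quoproj I) P (P' \o quoproj I)) => [|x|x]; last 2 first.
- by rewrite /= P'E.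
- by rewrite /= P'E.
rewrite -(tmap_comp _ _ _ lP' lP').
by have := t0; rewrite /quo2 => ->; exact: (lin0 (tmap_linear lP' lP')).
Qed.

End TensorIdeals.

(** * Rescaling homogeneous components by functions on [G] *)

Section HomogeneousScaling.
Context (G : groupType) (k : fieldType) (H : quasiHopfType k) (gr : qhGrading G H).
Implicit Types (psi chi : G -> k) (x y : H) (g h : G).

Definition hdecomp x : {malg H[G]} := sval (cid (homog_decomp gr x)).

Lemma hdecompP x :
  (forall g, gr g (hdecomp x)@_g) /\ x = \sum_(g <- msupp (hdecomp x)) (hdecomp x)@_g.
Proof. by rewrite /hdecomp; case: cid => D /= [[]]. Qed.

Lemma hdecomp_uniq x (D : {malg H[G]}) : (forall g, gr g D@_g) ->
  x = \sum_(g <- msupp D) D@_g -> hdecomp x = D.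
Proof. by move=> h1 h2; rewrite /hdecomp; case: cid => E /= [_ uE]; apply: uE. Qed.

Lemma hdecompE (E : {fset G}) x : (msupp (hdecomp x) `<=` E)%fset ->
  \sum_(g <- E) (hdecomp x)@_g = x.
Proof.
move=> hE; rewrite [RHS](hdecompP x).2.
by rewrite (msupp_sumEw (F := fun _ x => x) _ hE).
Qed.

Lemma hdecomp_lin a x y :
  (* The scalars of [{malg H[G]}] are elements of [H], so [a] enters as [a%:A]. *)
  hdecomp (a *: x + y) = a%:A *: hdecomp x + hdecomp y.
Proof.
set D := RHS; have DE g : D@_g = a *: (hdecomp x)@_g + (hdecomp y)@_g.
  by rewrite /D mcoeffD mcoeffZ mulr_algl.
apply: hdecomp_uniq => [g|].
  by rewrite DE; apply: (homog_subspace gr g).2; apply: (hdecompP _).1.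
pose E := (msupp D `|` (msupp (hdecomp x) `|` msupp (hdecomp y)))%fset.
have DsE : (msupp D `<=` E)%fset by apply: fsubsetUl.
rewrite (msupp_sumEw (F := fun _ x => x) _ DsE) //.
have xE : (msupp (hdecomp x) `<=` E)%fset.
  by apply: fsubset_trans (fsubsetUr _ _); apply: fsubsetUl.
have yE : (msupp (hdecomp y) `<=` E)%fset.
  by apply: fsubset_trans (fsubsetUr _ _); apply: fsubsetUr.
rewrite -[in LHS](hdecompE xE) -[in LHS](hdecompE yE) scaler_sumr -big_split.
by apply: eq_bigr => g _; rewrite DE.
Qed.

Lemma hdecomp_homog g x : gr g x -> hdecomp x = << x *g g >>.
Proof.
move=> gx; apply: hdecomp_uniq => [h|].
  rewrite mcoeffU; case: eqP => [<- //|_]; rewrite mulr0n.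
  by case: (homog_subspace gr h).
rewrite (msupp_sumEw (F := fun _ x => x) _ (msuppU_le)) //.
by rewrite big_seq_fset1 mcoeffUU.
Qed.

Definition hscale psi x : H := \sum_(g <- msupp (hdecomp x)) psi g *: (hdecomp x)@_g.

Lemma hscale_linear psi : linear (hscale psi).
Proof.
move=> a x y; pose E := (msupp (hdecomp (a *: x + y))
  `|` (msupp (hdecomp x) `|` msupp (hdecomp y)))%fset.
have xE : (msupp (hdecomp x) `<=` E)%fset.
  by apply: fsubset_trans (fsubsetUr _ _); apply: fsubsetUl.
have yE : (msupp (hdecomp y) `<=` E)%fset.
  by apply: fsubset_trans (fsubsetUr _ _); apply: fsubsetUr.
have zE : (msupp (hdecomp (a *: x + y)) `<=` E)%fset by apply: fsubsetUl.
have F0 g : psi g *: (0 : H) = 0 by rewrite scaler0.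
rewrite /hscale !(msupp_sumEw (F := fun g x => psi g *: x) F0 xE).
rewrite (msupp_sumEw (F := fun g x => psi g *: x) F0 yE).
rewrite (msupp_sumEw (F := fun g x => psi g *: x) F0 zE).
rewrite scaler_sumr -big_split; apply: eq_bigr => g _.
by rewrite hdecomp_lin mcoeffD mcoeffZ mulr_algl scalerDr !scalerA mulrC.
Qed.

Lemma hscale_homog psi g x : gr g x -> hscale psi x = psi g *: x.
Proof.
move=> gx; rewrite /hscale (hdecomp_homog gx).
rewrite (msupp_sumEw (F := fun g x => psi g *: x) _ (msuppU_le)) => [|h].
  by rewrite big_seq_fset1 mcoeffUU.
by rewrite scaler0.
Qed.

Lemma homog_ext (W : lmodType k) (f1 f2 : H -> W) : linear f1 -> linear f2 ->
  (forall g x, gr g x -> f1 x = f2 x) -> f1 =1 f2.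
Proof.
move=> l1 l2 h x; have [D hD ->] := homog_sum gr x.
by rewrite (lin_sum l1) (lin_sum l2); apply: eq_bigr => g _; apply: h (hD g).
Qed.

Lemma eq_hscale psi chi x : {in msupp (hdecomp x), psi =1 chi} -> hscale psi x = hscale chi x.
Proof. by move=> h; apply: eq_big_seq => g hg; rewrite h. Qed.

Lemma hscale_const a x : hscale (fun=> a) x = a *: x.
Proof.
move: x; apply: homog_ext => [||g x gx]; first exact: hscale_linear.
  by move=> b x y; rewrite scalerDr !scalerA mulrC.
by rewrite (hscale_homog _ gx).
Qed.

Lemma hscale_mul psi chi x :
  hscale (fun g => psi g * chi g) x = hscale psi (hscale chi x).
Proof.
move: x; apply: homog_ext => [||g x gx]; first exact: hscale_linear.
  exact: linear_comp (hscale_linear _) (hscale_linear _).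
rewrite !(hscale_homog _ gx) (linZ (hscale_linear _)) (hscale_homog _ gx).
by rewrite scalerA mulrC.
Qed.

Lemma hscale_lin a psi chi x :
  hscale (fun g => a * psi g + chi g) x = a *: hscale psi x + hscale chi x.
Proof.
rewrite /hscale scaler_sumr -big_split; apply: eq_bigr => g _.
by rewrite scalerDl scalerA.
Qed.

Lemma hscale_mull psi h x y : gr h x ->
  hscale psi (x * y) = x * hscale (fun g => psi (h * g)%g) y.
Proof.
move=> hx; move: y; apply: homog_ext => [||g y gy].
- exact: linear_comp (hscale_linear _) (mulr_linear_r x).
- exact: linear_comp (mulr_linear_r x) (hscale_linear _).
- by rewrite (hscale_homog _ (homogM hx gy)) (hscale_homog _ gy) scalerAr.
Qed.

Lemma hscale_mulr psi h x y : gr h y ->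
  hscale psi (x * y) = hscale (fun g => psi (g * h)%g) x * y.
Proof.
move=> hy; move: x; apply: homog_ext => [||g x gx].
- exact: linear_comp (hscale_linear _) (mulr_linear_l y).
- exact: linear_comp (mulr_linear_l y) (hscale_linear _).
- by rewrite (hscale_homog _ (homogM gx hy)) (hscale_homog _ gx) scalerAl.
Qed.

Lemma eps_hscale_linear psi : linear (fun x => eps (hscale psi x)).
Proof. exact: linear_comp (@eps_linear k H) (hscale_linear psi). Qed.

(** The right-hand side is the linear extension of [psi] to [k[G]], evaluated at [pi(x)].
    Functionals on [pi(I)] can thus be studied inside [H]. *)
Lemma eps_hscale psi x : eps (hscale psi x) = mlin (psi : G -> k^o) (grmap gr x).
Proof.
move: x; apply: homog_ext => [||g x gx]; first exact: eps_hscale_linear.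
  exact: linear_comp (mlin_linear _) (grmap_linear gr).
rewrite (hscale_homog _ gx) (grmap_homog gx) mlinU linearZ /=.
exact: mulrC.
Qed.

(** For [x] in [H_g] the second tensor factor of [Delta x] also lies in [H_g], so [psi] acts there
    as the scalar [psi g] and the counit axiom returns [psi g *: x]. In this form the scaling can be
    applied to the coideal condition on an ideal. *)
Lemma hscale_coaction psi x :
  hscale psi x = tsum (fun a b => (eps (hscale psi b) : k) *: a) (Delta x).
Proof.
have b1 chi : bilin (fun a b : H => (eps (hscale chi b) : k) *: a).
  split=> [b|a] c y z; first by rewrite scalerDr !scalerA mulrC.
  by rewrite (eps_hscale_linear chi) scalerDl scalerA.
have b2 : bilin (fun a b : H => (eps b : k) *: a).
  split=> [b|a] c y z; first by rewrite scalerDr !scalerA mulrC.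
  by rewrite eps_linear scalerDl scalerA.
move: x; apply: homog_ext => [||g x gx]; first exact: hscale_linear.
  exact: linear_comp (tsum_linear (b1 psi)) (@Delta_linear k H).
rewrite (hscale_homog _ gx) -{1}(counitr x).
move: (Delta x) (homog_Delta gx); apply: ttens_sub => [|a b ga gb].
  split=> [|c s t /= hs ht]; first by rewrite /= (lin0 (tsum_linear (b1 psi)))
    (lin0 (tsum_linear b2)) scaler0.
  by rewrite (tsum_linear (b1 psi)) (tsum_linear b2) scalerDr !scalerA mulrC -scalerA hs ht.
rewrite /= !tsum_pure // (hscale_homog _ gb) scalerA.
by rewrite (linZ (@eps_linear k H)).
Qed.

End HomogeneousScaling.

(** Lets the results on [H_N] be applied to the neutral component. *)
Lemma trivial_normal_subgroup (G : groupType) : normal_subgroup [set 1%g : G].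
Proof.
split=> // [x y -> ->|x ->|x g ->] /=; first by rewrite mulg1.
  by rewrite invg1.
by rewrite conj1g.
Qed.

(** * Coset components of [H] and the subalgebra [H_N] *)

Section Cosets.
Context (G : groupType) (k : fieldType) (H : quasiHopfType k) (gr : qhGrading G H).
Implicit Types (N : set G) (x y : H) (g h : G).

Definition coset_indicator N g : G -> k := fun h => (`[< N (g^-1 * h)%g >])%:R.

Definition coset_proj N g : H -> H := hscale gr (coset_indicator N g).

Lemma coset_proj_linear N g : linear (coset_proj N g).
Proof. exact: hscale_linear. Qed.

Lemma coset_proj_in N g h x : gr h x -> N (g^-1 * h)%g -> coset_proj N g x = x.
Proof.
by move=> hx Nh; rewrite /coset_proj (hscale_homog _ hx) /coset_indicator asboolT // scale1r.
Qed.

Lemma coset_proj_out N g h x : gr h x -> ~ N (g^-1 * h)%g -> coset_proj N g x = 0.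
Proof.
by move=> hx Nh; rewrite /coset_proj (hscale_homog _ hx) /coset_indicator asboolF // scale0r.
Qed.

Lemma Hcoset_subspace N g : subspace (Hcoset gr N g).
Proof. exact: lspan_subspace. Qed.

Lemma Hcoset_homog N g h x : gr h x -> N (g^-1 * h)%g -> Hcoset gr N g x.
Proof. by move=> hx Nh; apply: sub_lspan; exists (g^-1 * h)%g => //=; rewrite mulVKg. Qed.

Lemma Hsub_homog N h x : gr h x -> N h -> Hsub gr N x.
Proof. by move=> hx Nh; apply: Hcoset_homog hx _; rewrite invg1 mul1g. Qed.

Lemma Hcoset_ind N g (P : set H) : subspace P ->
  (forall h x, N (g^-1 * h)%g -> gr h x -> P x) -> Hcoset gr N g `<=` P.
Proof.
move=> sP h; apply: lspan_sub => // x [n Nn gx]; apply: (h (g * n)%g) => //.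
by rewrite mulKg.
Qed.

Lemma Hsub_ind N (P : set H) : subspace P ->
  (forall h x, N h -> gr h x -> P x) -> Hsub gr N `<=` P.
Proof.
by move=> sP hP; apply: Hcoset_ind => // h x; rewrite invg1 mul1g; apply: hP.
Qed.

Lemma coset_proj_id N g x : Hcoset gr N g x -> coset_proj N g x = x.
Proof.
move: x; apply: Hcoset_ind.
  split=> [|a x y /= hx hy]; first by rewrite /= (lin0 (coset_proj_linear N g)).
  by rewrite coset_proj_linear hx hy.
by move=> h x Nh hx; apply: coset_proj_in hx Nh.
Qed.

Lemma coset_proj_Hcoset N g x : Hcoset gr N g (coset_proj N g x).
Proof.
move: x; apply: (@homog_ind _ _ _ gr).
  have h0 := preim_subspace (coset_proj_linear N g) (Hcoset_subspace N g); exact h0.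
move=> h x hx; rewrite /preimage /=; have [Nh|Nh] := pselect (N (g^-1 * h)%g).
  by rewrite (coset_proj_in hx) //; apply: Hcoset_homog hx Nh.
by rewrite (coset_proj_out hx) //; case: (Hcoset_subspace N g).
Qed.

(* Inclusion-exclusion over the finitely many cosets met by the support of [x] writes
   [x] as a combination of iterated coset components. *)
Lemma coset_proj_sub N (I P : set H) : N 1%g -> subspace P ->
  (forall g x, I x -> I (coset_proj N g x)) ->
  (forall g x, I x -> P (coset_proj N g x)) -> I `<=` P.
Proof.
move=> N1 sP hI hP x Ix.
have h (s : seq G) : exists psi : G -> k,
    (forall g, g \in s -> psi g = 1) /\ (forall x, I x -> P (hscale gr psi x)).
  elim: s => [|g s [psi [psi1 hpsi]]].
    exists (fun=> 0); split=> // y _; rewrite hscale_const scale0r.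
    by case: sP.
  pose chi := coset_indicator N g.
  (* This is [1 - (1 - psi) (1 - chi)], arranged in the shape that [hscale_lin] rewrites. *)
  exists (fun h => -1 * (psi h * chi h) + (1 * psi h + chi h)); split=> [h|y Iy].
    rewrite inE => /orP[/eqP ->|hs]; last by rewrite psi1 // !mul1r mulN1r addrC addrK.
    by rewrite /chi /coset_indicator mulVg asboolT // mulr1 mulN1r mul1r addKr.
  rewrite hscale_lin hscale_mul hscale_lin; apply: sP.2.
    exact/hpsi/hI.
  by apply: sP.2; [exact: hpsi|exact: hP].
have [psi [psi1 hpsi]] := h (msupp (hdecomp gr x)).
rewrite -[x]scale1r -(hscale_const gr) (@eq_hscale _ _ _ _ _ psi) => [|g gs].
  exact: hpsi.
by rewrite psi1.
Qed.

Lemma Hsub_set1 : Hsub gr [set 1%g] = gr 1%g.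
Proof.
rewrite eqEsubset; split=> [|x hx]; last exact: Hsub_homog hx _.
by apply: Hsub_ind => [|h x -> //]; exact: homog_subspace.
Qed.

Section NormalSubgroup.
Context (N : set G) (nN : normal_subgroup N).

Let N1 : N 1%g. Proof. by case: nN. Qed.
Let NM g h : N g -> N h -> N (g * h)%g. Proof. by case: nN => _ h0 _ _; apply: h0. Qed.
Let NV g : N g -> N (g^-1)%g. Proof. by case: nN => _ _ h0 _; apply: h0. Qed.

Lemma normal_sub_conj g h : N h -> N (g * h * g^-1)%g.
Proof.
move=> Nh; have -> : (g * h * g^-1 = h ^ g^-1)%g by rewrite conjgE invgK mulgA.
by case: nN => _ _ _; apply.
Qed.

Lemma HsubM x y : Hsub gr N x -> Hsub gr N y -> Hsub gr N (x * y).
Proof.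
move=> hx; move: y; apply: Hsub_ind => [|h y Nh hy].
  have h0 := preim_subspace (mulr_linear_r x) (Hcoset_subspace N 1); exact h0.
move: x hx; apply: Hsub_ind => [|g x Ng gx].
  have h0 := preim_subspace (mulr_linear_l y) (Hcoset_subspace N 1); exact h0.
exact: Hsub_homog (homogM gx hy) (NM Ng Nh).
Qed.

Lemma Hsub_conj g x y z : gr g x -> Hsub gr N y -> gr (g^-1)%g z -> Hsub gr N (x * y * z).
Proof.
move=> gx hy gz; move: y hy; apply: Hsub_ind => [|h y Nh hy].
  have h0 := preim_subspace (linear_comp (mulr_linear_l z) (mulr_linear_r x))
    (Hcoset_subspace N 1); exact h0.
exact: Hsub_homog (homogM (homogM gx hy) gz) (normal_sub_conj g Nh).
Qed.

Lemma Hsub_antip x : Hsub gr N x -> Hsub gr N (antip x).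
Proof.
move: x; apply: Hsub_ind => [|g x Ng gx].
  have h0 := preim_subspace (@antip_linear k H) (Hcoset_subspace N 1); exact h0.
exact: Hsub_homog (homog_antip gx) (NV Ng).
Qed.

Lemma Hsub_Delta x : Hsub gr N x -> ttens (Hsub gr N) (Hsub gr N) (Delta x).
Proof.
move: x; apply: Hsub_ind => [|g x Ng gx].
  have h0 := preim_subspace (@Delta_linear k H) (ttens_subspace (Hsub gr N) (Hsub gr N)).
  exact h0.
by apply: (ttensS _ _ (homog_Delta gx)) => y gy; apply: Hsub_homog gy Ng.
Qed.

(** For [a] in [H_g] and [x] in [K], the product [a * x] lies in the component of the coset [g N].
    Its part in [H_N] is therefore zero when [g] is outside [N], and [a * x] itself, an element of
    [K], otherwise. *)
Lemma prodset_ideal_Hsub (K : set H) : subspace K -> K `<=` Hsub gr N ->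
  (forall a x, Hsub gr N a -> K x -> K (a * x)) ->
  forall x, prodset [set: H] K x -> K (coset_proj N 1 x).
Proof.
move=> sK KN mK; apply: lspan_sub.
  have h0 := preim_subspace (coset_proj_linear N 1) sK; exact h0.
move=> _ [a _ [x Kx <-]]; move: a; apply: (@homog_ind _ _ _ gr).
  have h0 := preim_subspace (linear_comp (coset_proj_linear N 1) (mulr_linear_l x)) sK.
  exact h0.
move=> g a ga; have [Ng|Ng] := pselect (N g).
  have aN := Hsub_homog ga Ng.
  rewrite /= (coset_proj_id (HsubM aN (KN _ Kx))); exact: mK.
rewrite /=; suff -> : coset_proj N 1 (a * x) = 0 by case: sK.
have Nx := KN _ Kx; move: {Kx} x Nx; apply: Hsub_ind.
  have h0 := preim_subspace (linear_comp (coset_proj_linear N 1) (mulr_linear_r a))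
    (subspace_set0 _); exact h0.
move=> h x Nh hx; apply: coset_proj_out (homogM ga hx) _.
rewrite invg1 mul1g => Ngh; apply: Ng.
by rewrite -[g](mulgK h); apply: NM => //; apply: NV.
Qed.

End NormalSubgroup.

(** The case [N = 1], [K = J] of [prodset_ideal_Hsub]. *)
Lemma prodset_homog1 (J : set H) : qh_ideal (gr 1%g) J ->
  forall x, gr 1%g x -> prodset [set: H] J x -> J x.
Proof.
move=> hJ x x1 Jx; have E := Hsub_set1.
have <- : coset_proj [set 1%g] 1%g x = x by apply: (coset_proj_in x1); rewrite mulg1 invg1.
apply: prodset_ideal_Hsub Jx; first exact: trivial_normal_subgroup.
- exact: (qhi_subspace hJ).
- by rewrite E; exact: (qhi_sub hJ).
- by rewrite E => a y; apply: (qhi_mull hJ).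
Qed.

End Cosets.

(** * Faithful gradings are strong *)

Section StrongGrading.
Context (G : groupType) (k : fieldType) (H : quasiHopfType k) (gr : qhGrading G H).
Context (faithful_gr : faithfully_graded gr).
Implicit Types (x y : H) (g h : G) (W : set H).

(** If [eps] vanished on [H_g], the counit axiom applied to [Delta x] in [H_g \ox H_g] would give
    [x = 0] for every [x] in [H_g]. *)
Lemma homog_eps1 g : exists2 x, gr g x & eps x = 1.
Proof.
have sg := homog_subspace gr g.
have [[x [gx x0]]|h] := pselect (exists x, gr g x /\ x <> 0); last first.
  case: (faithful_gr (g := g)); rewrite eqEsubset; split=> [x gx|_ ->]; last by case: sg.
  by apply: contrapT => x0; apply: h; exists x.
have [[y [gy y0]]|h] := pselect (exists y, gr g y /\ eps y != 0 :> k).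
  exists ((eps y : k)^-1 *: y); first exact: subspaceZ.
  by rewrite (linZ (@eps_linear k H)); exact: mulVf.
case: x0; rewrite -(counitr x); move: (Delta x) (homog_Delta gx).
have b : bilin (fun a b : H => (eps b : k) *: a).
  split=> [b|a] c y z; first by rewrite scalerDr !scalerA mulrC.
  by rewrite eps_linear scalerDl scalerA.
apply: ttens_sub.
  have h0 := preim_subspace (tsum_linear b) (subspace_set0 _); exact h0.
move=> u v gu gv; rewrite /= tsum_pure //; have [->|v0] := eqVneq (eps v : k) 0.
  by rewrite scale0r.
by case: h; exists v.
Qed.

(* The element [x' beta S(x'')] with [x] in [H_g] and [eps x = 1] shows that the ideal
   [H_g H_(g^-1)] of [H_e] contains [beta]; the antipode axiom for [Phi] turns [beta]
   into [1]. *)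
Lemma strong_unit g : prodset (gr g) (gr (g^-1)%g) 1.
Proof.
set W := prodset _ _; have sW : subspace W := prodset_subspace _ _.
have Wl a x : gr 1%g a -> W x -> W (a * x).
  move=> ga; move: x; apply: lspan_sub.
    have h0 := preim_subspace (mulr_linear_r a) sW; exact h0.
  move=> _ [u gu [v gv <-]]; rewrite /= mulrA; apply: prodset_mem => //.
  by rewrite -[g]mul1g; apply: homogM.
have Wr a x : gr 1%g a -> W x -> W (x * a).
  move=> ga; move: x; apply: lspan_sub.
    have h0 := preim_subspace (mulr_linear_l a) sW; exact h0.
  move=> _ [u gu [v gv <-]]; rewrite /= -mulrA; apply: prodset_mem => //.
  by rewrite -[(g^-1)%g]mulg1; apply: homogM.
have Wbeta : W beta.
  have [x gx x1] := homog_eps1 g; have := antip_beta x; rewrite x1 scale1r => <-.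
  move: (Delta x) (homog_Delta gx).
  have b : bilin (fun a b : H => a * beta * antip b).
    split=> [b|a] c y z; first by rewrite !mulrDl -!scalerAl.
    by rewrite antip_linear mulrDr -scalerAr.
  apply: ttens_sub => [|u v gu gv].
    have h0 := preim_subspace (tsum_linear b) sW; exact h0.
  rewrite /= tsum_pure //; apply: prodset_mem; last exact: homog_antip.
  by rewrite -[g]mulg1; apply: homogM => //; exact: homog_beta.
rewrite -(@antip_Phi k H); move: Phi (@homog_Phi _ _ _ gr).
have b1 c : bilin (fun a b : H => a * beta * antip b * alpha * c).
  split=> [b|a] d y z; first by rewrite !mulrDl -!scalerAl.
  by rewrite antip_linear !mulrDr !mulrDl -!scalerAr -!scalerAl.
have b2 : bilin (fun (t : H \ox H) (c : H) =>
    tsum (fun a b : H => a * beta * antip b * alpha * c) t).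
  apply: (@bilin_tsum_l k _ _ _ _ (fun a b c : H => a * beta * antip b * alpha * c)) => //.
  by move=> a b d y z; rewrite mulrDr -scalerAr.
apply: ttens_sub => [|t c ht gc].
  have h0 := preim_subspace (tsum_linear b2) sW; exact h0.
rewrite /= tsum_pure //; move: t ht; apply: ttens_sub => [|a b ga gb].
  have h0 := preim_subspace (tsum_linear (b1 c)) sW; exact h0.
rewrite /= tsum_pure //; apply: (Wr) => //; apply: (Wr); first exact: homog_alpha.
by apply: Wr; [rewrite -[1%g]invg1; apply: homog_antip|apply: Wl].
Qed.

(** Strong grading as a reasoning principle: [1] is a sum of products [a * b], so [x] is a sum of
    the [a * b * x]. *)
Lemma strong_left g W x : subspace W ->
  (forall a b, gr g a -> gr (g^-1)%g b -> W (a * b * x)) -> W x.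
Proof.
move=> sW h; rewrite -[x]mul1r; move: 1 (@strong_unit g); apply: lspan_sub.
  have h0 := preim_subspace (mulr_linear_l x) sW; exact h0.
by move=> _ [a ga [b gb <-]]; apply: h.
Qed.

Lemma strong_right g W x : subspace W ->
  (forall a b, gr g a -> gr (g^-1)%g b -> W (x * (a * b))) -> W x.
Proof.
move=> sW h; rewrite -[x]mulr1; move: 1 (@strong_unit g); apply: lspan_sub.
  have h0 := preim_subspace (mulr_linear_r x) sW; exact h0.
by move=> _ [a ga [b gb <-]]; apply: h.
Qed.

End StrongGrading.

(** * The annihilator of [pi(I)] and the subgroup [N_I] *)

Section NormalSubgroupOfIdeal.
Context (G : groupType) (k : fieldType) (H : quasiHopfType k) (gr : qhGrading G H).
Context (I : set H) (hI : qh_ideal [set: H] I).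
Context (faithful_gr : faithfully_graded gr).
Implicit Types (psi chi : G -> k) (x y : H) (g h : G).

(* The functionals on [k[G]] that vanish on [pi(I)], as functions on [G]. *)
Definition annihilates psi : Prop := forall x, I x -> eps (hscale gr psi x) = 0.

(** By [hscale_coaction]: the summand of [Delta x] in [I \ox H] is sent into [I], and the one in
    [H \ox I] to zero. This is what makes the annihilator closed under products. *)
Lemma hscale_annihilates psi x : annihilates psi -> I x -> I (hscale gr psi x).
Proof.
move=> hpsi Ix; rewrite hscale_coaction; have sI := qhi_subspace hI.
have b : bilin (fun a b : H => (eps (hscale gr psi b) : k) *: a).
  split=> [b|a] c y z; first by rewrite scalerDr !scalerA mulrC.
  by rewrite (eps_hscale_linear gr psi) scalerDl scalerA.
move: (Delta x) (qhi_Delta hI Ix); apply: tcoideal_sub => [|u v Iu _|u v _ Iv].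
- have h0 := preim_subspace (tsum_linear b) sI; exact h0.
- by rewrite /= tsum_pure //; apply: subspaceZ.
- by rewrite /= tsum_pure // hpsi // scale0r; case: sI.
Qed.

Lemma annihilates_const (a : k) : annihilates (fun=> a).
Proof.
by move=> x Ix; rewrite hscale_const (linZ (@eps_linear k H)) (qhi_eps hI Ix) scaler0.
Qed.

Lemma annihilates_lin a psi chi : annihilates psi -> annihilates chi ->
  annihilates (fun g => a * psi g + chi g).
Proof.
by move=> h1 h2 x Ix; rewrite hscale_lin eps_linear h1 // h2 // scaler0 addr0.
Qed.

Lemma annihilatesM psi chi : annihilates psi -> annihilates chi ->
  annihilates (fun g => psi g * chi g).
Proof.
move=> h1 h2 x Ix; rewrite hscale_mul; apply: h1; exact: hscale_annihilates.
Qed.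

(** Multiplying [x] by an element of degree [h] and counit [1] stays in the ideal and translates
    [psi]. *)
Lemma annihilates_lshift h psi : annihilates psi -> annihilates (fun g => psi (h * g)%g).
Proof.
move=> hpsi x Ix; have [u hu u1] := homog_eps1 faithful_gr h.
have := hpsi (u * x) (qhi_mull hI Logic.I Ix).
by rewrite (hscale_mull _ _ hu) rmorphM /= u1 mul1r.
Qed.

Lemma annihilates_rshift h psi : annihilates psi -> annihilates (fun g => psi (g * h)%g).
Proof.
move=> hpsi x Ix; have [u hu u1] := homog_eps1 faithful_gr h.
have := hpsi (x * u) (qhi_mulr hI Logic.I Ix).
by rewrite (hscale_mulr _ _ hu) rmorphM /= u1 mulr1.
Qed.

(** For the converse, a functional that vanishes on [pi(I)] but not on [<< g >> - << 1%g >>]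
    restricts to an annihilating function with distinct values at [g] and [1]. *)
Lemma NidealP g : Nideal gr I g <-> forall psi, annihilates psi -> psi g = psi 1%g.
Proof.
split=> [[x Ix xE] psi hpsi|h].
  have := hpsi x Ix; rewrite eps_hscale xE (linB (mlin_linear _)) !mlinU1 => /eqP.
  by rewrite subr_eq0 => /eqP.
apply: contrapT => ng.
have sI : subspace (grmap gr @` I).
  exact: image_subspace (grmap_linear gr) _ (qhi_subspace hI).
have [f [fl fI f1]] := functional_sep sI ng.
have fE D : f D = mlin (fun g => f << g >>) D.
  rewrite {1}[D]monalgE (lin_sum fl); apply: eq_bigr => h0 _.
  rewrite -(linZ fl); congr (f _).
  by apply/malgP=> p; rewrite mcoeffZ !mcoeffU mulrnAr mulr1.
have /h E : annihilates (fun g => f << g >>).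
  by move=> x Ix; rewrite eps_hscale -fE; apply: fI; exists x.
by move: f1; rewrite (linB fl) E subrr => /eqP; rewrite eq_sym oner_eq0.
Qed.

Lemma Nideal_coset psi g h : annihilates psi -> Nideal gr I (g^-1 * h)%g -> psi h = psi g.
Proof.
move=> hpsi /NidealP /(_ _ (annihilates_lshift g hpsi)).
by rewrite mulVKg mulg1.
Qed.

(** Each nontrivial axiom is [NidealP] read for suitable translates of [psi], which annihilate
    again; conjugation needs a translation on both sides. *)
Lemma Nideal_normal : normal_subgroup (Nideal gr I).
Proof.
split=> [|g h /NidealP hg /NidealP hh|g /NidealP hg|g h /NidealP hg]; apply/NidealP => psi hpsi.
- by [].
- by rewrite (hh _ (annihilates_lshift g hpsi)) mulg1; apply: hg.
- by rewrite -[(g^-1)%g]mulg1 -(hg _ (annihilates_lshift (g^-1)%g hpsi)) mulVg.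
- rewrite conjgE.
  have hpsi' := annihilates_lshift (h^-1)%g (annihilates_rshift h hpsi).
  by have := hg _ hpsi'; rewrite mulg1 mulVg -mulgA.
Qed.

(* Since [k[G] / pi(I)] is spanned by group-likes, functions in the annihilator
   separate the cosets of [N_I]; being closed under products, it contains functions
   with prescribed values on finitely many cosets. *)
Lemma coset_separation g (s : seq G) : exists psi, [/\ annihilates psi,
  forall h, Nideal gr I (g^-1 * h)%g -> psi h = 1
  & forall h, h \in s -> ~ Nideal gr I (g^-1 * h)%g -> psi h = 0].
Proof.
elim: s => [|h s [psi [hpsi psi1 psi0]]].
  by exists (fun=> 1); split=> //; exact: annihilates_const.
have [Nh|Nh] := pselect (Nideal gr I (g^-1 * h)%g).
  exists psi; split=> // h'; rewrite inE => /orP[/eqP -> //|]; exact: psi0.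
have [chi [hchi chi_neq]] : exists chi, annihilates chi /\ chi h <> chi g.
  apply: contrapT => nchi; apply: Nh; apply/NidealP => chi hchi.
  apply: contrapT => E; apply: nchi; exists (fun h' => chi (g^-1 * h')%g).
  by split; [exact: annihilates_lshift|rewrite mulVg].
have d0 : chi g - chi h != 0 by rewrite subr_eq0 eq_sym; apply/eqP.
pose c := (chi g - chi h)^-1.
(* The new factor is the Lagrange quotient [(chi - chi h) / (chi g - chi h)], equal to [1] on the
   coset of [g] and to [0] at [h]. *)
exists (fun h' => psi h' * (c * chi h' + - (c * chi h))); split.
- by apply: annihilatesM => //; apply: annihilates_lin => //; exact: annihilates_const.
- move=> h' Nh'; rewrite psi1 // mul1r (Nideal_coset hchi Nh') -mulrBr.
  by rewrite mulVf.
- move=> h'; rewrite inE => /orP[/eqP -> _|h's Nh']; first by rewrite subrr mulr0.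
  by rewrite (psi0 _ h's Nh') mul0r.
Qed.

(** On the finite support of [x] the coset indicator agrees with an annihilating function, and
    scaling by the latter preserves [I]. *)
Lemma coset_proj_ideal g x : I x -> I (coset_proj gr (Nideal gr I) g x).
Proof.
move=> Ix; have [psi [hpsi psi1 psi0]] := coset_separation g (msupp (hdecomp gr x)).
rewrite /coset_proj (@eq_hscale _ _ _ _ _ psi); first exact: hscale_annihilates.
move=> h hs; rewrite /coset_indicator; case: asboolP => Nh; first by rewrite psi1.
by rewrite psi0.
Qed.

End NormalSubgroupOfIdeal.

(** * The structure maps of the lifted quotient on classes *)

Section LiftedQuotient.
Context (G : groupType) (k : fieldType) (H : quasiHopfType k) (gr : qhGrading G H).
Context (J : set H).
Implicit Types (x y : H).

Lemma lproj_linear : linear (lproj gr J).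
Proof. exact: quoproj_linear. Qed.

Lemma lprojM x y : lproj gr J (x * y) = lproj gr J x * lproj gr J y.
Proof. exact: quoM. Qed.

Lemma lproj_Delta x : Delta (lproj gr J x) = quo2 (lifted gr J) (Delta x).
Proof. exact: quoDeltaE. Qed.

Lemma lproj_eps x : eps (lproj gr J x) = eps x.
Proof. exact: quoepsE. Qed.

Lemma lproj_antip x : antip (lproj gr J x) = lproj gr J (antip x).
Proof. exact: quoantipE. Qed.

Lemma lproj_eq x y : qh_ideal (gr 1%g) J -> ginvariant gr J ->
  lproj gr J x = lproj gr J y <-> prodset [set: H] J (x - y).
Proof. by move=> hJ iJ; rewrite -(liftedE hJ iJ); exact: quoproj_eq. Qed.

End LiftedQuotient.

Lemma prodsetS (k : fieldType) (A : algType k) (U U' V V' : set A) :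
  U `<=` U' -> V `<=` V' -> prodset U V `<=` prodset U' V'.
Proof.
move=> hU hV; apply: lspan_sub; first exact: prodset_subspace.
by move=> _ [u Uu [v Vv <-]]; apply: prodset_mem; [apply: hU|apply: hV].
Qed.

(** * From a quasi-Hopf ideal to a reduced admissible datum and back *)

Section DatumOfIdeal.
Context (G : groupType) (k : fieldType) (H : quasiHopfType k) (gr : qhGrading G H).
Context (faithful_gr : faithfully_graded gr).
Context (I : set H) (hI : qh_ideal [set: H] I).
Implicit Types (x y : H) (g h : G).

Let sI := qhi_subspace hI.
Let mI a x : I x -> I (a * x). Proof. exact: (qhi_mull hI). Qed.
Let Im a x : I x -> I (x * a). Proof. exact: (qhi_mulr hI). Qed.

Local Notation J := (I `&` gr 1%g).
Local Notation N := (Nideal gr I).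
Local Notation q := (lproj gr J).

Let nN : normal_subgroup N := Nideal_normal hI faithful_gr.

Lemma neutral_qh_ideal : qh_ideal (gr 1%g) J.
Proof.
split.
- by move=> x [].
- exact: subspaceI sI (homog_subspace gr 1%g).
- by move=> a x ga [Ix gx]; split; [exact: mI|rewrite -[1%g]mul1g; exact: homogM].
- by move=> a x ga [Ix gx]; split; [exact: Im|rewrite -[1%g]mul1g; exact: homogM].
- move=> x [Ix gx]; apply: tcoidealI => //; first exact: homog_subspace.
  by split; [exact: (qhi_Delta hI)|exact: homog_Delta].
- by move=> x [Ix _]; exact: (qhi_eps hI).
- by move=> x [Ix gx]; split; [exact: (qhi_antip hI)|rewrite -invg1; exact: homog_antip].
Qed.

(** Write [1] as a sum of [a * b] with [a] in [H_(g^-1)] and [b] in [H_g]: then [x * j] is the sum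
    of the [(x * j * a) * b], where [x * j * a] lies in [I] and has degree [1]. The other inclusion
    is symmetric. *)
Lemma neutral_ginvariant : ginvariant gr J.
Proof.
move=> g; rewrite eqEsubset; split; apply: lspan_sub; try exact: prodset_subspace.
  move=> _ [x gx [j [Ij gj] <-]].
  apply: (strong_right faithful_gr (g := g^-1)) => [|a b ga gb].
    exact: prodset_subspace.
  rewrite invgK in gb; rewrite mulrA; apply: prodset_mem => //; split.
    exact/Im/mI.
  by have := homogM (homogM gx gj) ga; rewrite mulg1 mulgV.
move=> _ [j [Ij gj] [x gx <-]].
apply: (strong_left faithful_gr (g := g)) => [|a b ga gb].
  exact: prodset_subspace.
rewrite -mulrA; apply: prodset_mem => //; split; first exact/mI/Im.
by have := homogM gb (homogM gj gx); rewrite mul1g mulVg.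
Qed.

Lemma lifted_neutral_sub : prodset [set: H] J `<=` I.
Proof. by apply: lspan_sub => // _ [a _ [j [Ij _] <-]]; apply: mI. Qed.

Lemma lproj_ideal x y : q x = q y -> I y -> I x.
Proof.
move=> /(lproj_eq _ _ neutral_qh_ideal neutral_ginvariant) /lifted_neutral_sub Ixy Iy.
by rewrite -[x](subrK y); apply: subspaceD.
Qed.

(** The coideal condition is first obtained in [H] from [tcoidealI], then pushed forward by the
    tensor square of [q]. *)
Lemma lifted_sub_qh_ideal : qh_ideal (q @` Hsub gr N) (q @` (I `&` Hsub gr N)).
Proof.
have sN := Hcoset_subspace gr N 1; have ql := lproj_linear gr J.
split.
- by move=> _ [x [_ Nx] <-]; exists x.
- exact: image_subspace ql _ (subspaceI sI sN).
- move=> _ _ [a Na <-] [x [Ix Nx] <-]; exists (a * x); last exact: lprojM.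
  by split; [exact: mI|exact: HsubM].
- move=> _ _ [a Na <-] [x [Ix Nx] <-]; exists (x * a); last exact: lprojM.
  by split; [exact: Im|exact: HsubM].
- move=> _ [x [Ix Nx] <-].
  suff h : tcoideal (q @` (I `&` Hsub gr N)) (q @` Hsub gr N) (quo2 (lifted gr J) (Delta x)).
    by rewrite lproj_Delta; exact: h.
  have : tcoideal (I `&` Hsub gr N) (Hsub gr N) (Delta x).
    apply: tcoidealI => //; split; first exact: (qhi_Delta hI).
    exact: Hsub_Delta.
  move: (Delta x) {Ix Nx}; apply: tcoideal_sub => [|u v Iu Nv|u v Nu Iv].
  + have h0 := preim_subspace (@quo2_linear _ _ (lifted gr J))
      (tcoideal_subspace (q @` (I `&` Hsub gr N)) (q @` Hsub gr N)); exact h0.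
  + by rewrite /= /quo2 tmapE //; apply: tcoideal_l; [exists u|exists v].
  + by rewrite /= /quo2 tmapE //; apply: tcoideal_r; [exists u|exists v].
- by move=> _ [x [Ix _] <-]; rewrite lproj_eps; exact: (qhi_eps hI).
- move=> _ [x [Ix Nx] <-]; rewrite lproj_antip; exists (antip x) => //.
  by split; [exact: (qhi_antip hI)|exact: Hsub_antip].
Qed.

(** The argument of [neutral_ginvariant], with [Hsub_conj], hence normality of [N], keeping
    [x * y * a] in [H_N]. *)
Lemma lifted_sub_commute g : prodset (q @` Hcoset gr N g) (q @` (I `&` Hsub gr N))
  = prodset (q @` (I `&` Hsub gr N)) (q @` Hcoset gr N g).
Proof.
have ql := lproj_linear gr J.
set A := q @` Hcoset gr N g; set L := q @` _.
rewrite eqEsubset; split; apply: lspan_sub; try exact: prodset_subspace.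
  move=> _ [_ [x gx <-] [_ [y [Iy Ny] <-] <-]]; rewrite -lprojM.
  move: x gx; apply: Hcoset_ind => [|h x Nh hx].
    have h0 := preim_subspace (linear_comp ql (mulr_linear_l y)) (prodset_subspace L A).
    exact h0.
  have h0 := preim_subspace ql (prodset_subspace L A).
  apply: (strong_right faithful_gr (g := h^-1) h0) => a b ha hb.
  rewrite invgK in hb; rewrite /= mulrA lprojM; apply: prodset_mem.
    exists (x * y * a) => //; split; first exact/Im/mI.
    exact: Hsub_conj ha.
  by exists b => //; apply: Hcoset_homog hb Nh.
move=> _ [_ [y [Iy Ny] <-] [_ [x gx <-] <-]]; rewrite -lprojM.
move: x gx; apply: Hcoset_ind => [|h x Nh hx].
  have h0 := preim_subspace (linear_comp ql (mulr_linear_r y)) (prodset_subspace A L).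
  exact h0.
have h0 := preim_subspace ql (prodset_subspace A L).
apply: (strong_left faithful_gr (g := h) h0) => a b ha hb.
rewrite /= -mulrA lprojM; apply: prodset_mem.
  by exists a => //; apply: Hcoset_homog ha Nh.
exists (b * (y * x)) => //; split; first exact/mI/Im.
by rewrite mulrA; apply: Hsub_conj hb Ny _; rewrite ?invgK.
Qed.

(** An element of [I] over [<< n >> - << 1%g >>] may be replaced by its component in [H_N], which
    stays in [I]. *)
Lemma augideal_lifted_sub : augideal N `<=` lgrmap (J := J) @` (q @` (I `&` Hsub gr N)).
Proof.
have ql := lproj_linear gr J.
have E : lgrmap (J := J) @` (q @` (I `&` Hsub gr N)) = grmap gr @` (I `&` Hsub gr N).
  rewrite eqEsubset; split=> [_ [_ [x hx <-] <-]|_ [x hx <-]].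
    by exists x => //; rewrite lgrmapE.
  by exists (q x); [exists x|rewrite lgrmapE].
rewrite E; apply: lspan_sub.
  apply: image_subspace (grmap_linear gr) _ (subspaceI sI (Hcoset_subspace gr N 1)).
move=> _ [n Nn <-]; have [x Ix xE] := Nn.
exists (coset_proj gr N 1 x); first by split; [exact: coset_proj_ideal|exact: coset_proj_Hcoset].
have l1 : linear (fun x => grmap gr (coset_proj gr N 1 x)).
  exact: linear_comp (grmap_linear gr) (coset_proj_linear gr N 1).
have l2 : linear (mlin (fun g => coset_indicator k N 1 g *: << g >> : {malg k[G]})).
  exact: mlin_linear.
(* [pi] carries the projection onto [H_N] to the truncation of [k[G]] to [k[N]], which fixes
   [<< n >> - << 1%g >>]. *)
transitivity (mlin (fun g => coset_indicator k N 1 g *: << g >> : {malg k[G]}) (grmap gr x)).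
  move: x {Ix xE}; apply: (homog_ext (gr := gr)) => //.
    exact: linear_comp l2 (grmap_linear gr).
  move=> g x gx; rewrite (grmap_homog gx) mlinU /coset_proj (hscale_homog _ gx).
  rewrite (linZ (grmap_linear gr)) (grmap_homog gx) scalerA mulrC -scalerA.
  congr (_ *: _); apply/malgP => h; rewrite mcoeffZ !mcoeffU.
  by rewrite mulrnAr mulr1.
rewrite xE (linB l2) !mlinU1 /coset_indicator !invg1 !mul1g.
by rewrite asboolT // asboolT ?scale1r //; case: nN.
Qed.

Lemma datum_of_ideal_admissible : reduced_admissible (datum_of_ideal gr I).
Proof.
split=> /=.
- exact: nN.
- exact: neutral_qh_ideal.
- exact: neutral_ginvariant.
- exact: lifted_sub_qh_ideal.
(* A class represented both by an element of [I] and by [y] in [H_e] forces [y] into [I], because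
   [H J] lies in [I]; so [y] is in [J] and the class is zero. *)
- have ql := lproj_linear gr J.
  rewrite eqEsubset; split=> [_ [[x [Ix Nx] <-] [y gy xy]]|_ ->] /=; last first.
    split; exists 0; rewrite ?(lin0 ql) //; last by case: (homog_subspace gr 1%g).
    by split; [case: sI|case: (Hcoset_subspace gr N 1)].
  have Jy : J y by split=> //; apply: lproj_ideal xy Ix.
  rewrite -xy -(lin0 ql); apply/(lproj_eq _ _ neutral_qh_ideal neutral_ginvariant).
  by rewrite subr0 -[y]mul1r; apply: prodset_mem.
- exact: augideal_lifted_sub.
- exact: lifted_sub_commute.
Qed.

Lemma Kpreim_datum_of_ideal : Kpreim (datum_of_ideal gr I) = I `&` Hsub gr N.
Proof.
rewrite eqEsubset; split=> [x [Nx [y [Iy _] xy]]|x [Ix Nx]].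
  by split=> //; apply: lproj_ideal (esym xy) Iy.
by split=> //; exists x.
Qed.

(** By [coset_proj_sub] it suffices to treat a coset component [y] of an element of [I]. It is a sum
    of products [a * (b * y)] with [b] of degree [g^-1], and [b * y] lies in [I] and in [H_N]. *)
Lemma datum_of_idealK : ideal_of_datum (datum_of_ideal gr I) = I.
Proof.
rewrite /ideal_of_datum Kpreim_datum_of_ideal eqEsubset; split=> [|x Ix].
  apply: lspan_sub => // x [g _]; move: x; apply: lspan_sub => // _ [a _ [x [Ix _] <-]].
  exact: mI.
have S := lspan_subspace (\bigcup_(g in [set: G]) prodset (Hcoset gr N g) (I `&` Hsub gr N)).
have [N1 _ _ _] := nN.
move: x Ix; apply: (coset_proj_sub N1 S) => [g x|g x Ix]; first exact: coset_proj_ideal.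
have Ig := coset_proj_ideal hI faithful_gr g Ix.
have Ng := @coset_proj_Hcoset _ _ _ gr N g x.
apply: (strong_left faithful_gr (g := g) S) => a b ga gb.
rewrite -mulrA; apply: sub_lspan; exists g => //; apply: prodset_mem.
  by apply: Hcoset_homog ga _; rewrite mulVg.
split; first exact: mI.
move: (coset_proj _ _ _ _) Ng {Ig}; apply: Hcoset_ind => [|h y Nh hy].
  have h0 := preim_subspace (mulr_linear_r b) (Hcoset_subspace gr N 1); exact h0.
by apply: Hsub_homog (homogM gb hy) Nh.
Qed.

End DatumOfIdeal.

(** * From a reduced admissible datum to a quasi-Hopf ideal and back *)

Section IdealOfDatum.
Context (G : groupType) (k : fieldType) (H : quasiHopfType k) (gr : qhGrading G H).
Context (d : datum gr) (hd : reduced_admissible d).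
Implicit Types (x y : H) (g h : G).

Local Notation N := (dN d).
Local Notation J := (dJ d).
Local Notation L := (dL (d := d)).
Local Notation q := (lproj gr J).
Local Notation K := (Kpreim d).
Local Notation I := (prodset [set: H] K).

Let nN := ra_normal hd.
Let hJ := ra_ideal hd.
Let iJ := ra_invariant hd.
Let hL := ra_qh_ideal hd.
Let ql := lproj_linear gr J.
Let sN := Hcoset_subspace gr N 1.
Let sI : subspace I. Proof. exact: prodset_subspace. Qed.

Lemma Kpreim_subspace : subspace K.
Proof. exact: subspaceI sN (preim_subspace ql (qhi_subspace hL)). Qed.

(** Every homogeneous element lies in the component of its own coset, so the sum over cosets is
    simply [H K]. *)
Lemma ideal_of_datumE : ideal_of_datum d = I.
Proof.
have S := lspan_subspace (\bigcup_(g in [set: G]) prodset (Hcoset gr N g) K).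
rewrite eqEsubset; split; apply: lspan_sub => //.
  by move=> x [g _]; apply: prodsetS.
move=> _ [a _ [x Kx <-]]; move: a; apply: (@homog_ind _ _ _ gr).
  have h0 := preim_subspace (mulr_linear_l x) S; exact h0.
move=> g a ga; apply: sub_lspan; exists g => //; apply: prodset_mem => //.
by apply: Hcoset_homog ga _; rewrite mulVg; case: nN.
Qed.

Lemma Kpreim_sub_ideal x : K x -> I x.
Proof. by move=> Kx; rewrite -[x]mul1r; apply: prodset_mem. Qed.

Lemma dJ_sub_Kpreim x : J x -> K x.
Proof.
move=> Jx; split; first by apply: Hsub_homog (qhi_sub hJ Jx) _; case: nN.
suff E : q x = 0 by rewrite /preimage /= E; case: (qhi_subspace hL).
rewrite -(lin0 ql); apply/(lproj_eq _ _ hJ iJ); rewrite subr0 -[x]mul1r.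
exact: prodset_mem.
Qed.

Lemma lifted_sub_ideal : prodset [set: H] J `<=` I.
Proof. by apply: prodsetS => // x; apply: dJ_sub_Kpreim. Qed.

Lemma Kpreim_mull a x : Hsub gr N a -> K x -> K (a * x).
Proof.
move=> Na [Nx Lx]; split; first exact: HsubM.
by rewrite /preimage /= lprojM; apply: (qhi_mull hL) => //; exists a.
Qed.

Lemma Kpreim_eps x : K x -> eps x = 0.
Proof. by move=> [_ Lx]; rewrite -(lproj_eps gr J); exact: (qhi_eps hL). Qed.

Lemma Kpreim_antip x : K x -> K (antip x).
Proof.
move=> [Nx Lx]; split; first exact: Hsub_antip.
by rewrite /preimage /= -lproj_antip; exact: (qhi_antip hL).
Qed.

Lemma ideal_of_datum_mull a x : I x -> I (a * x).
Proof.
move: x; apply: lspan_sub.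
  have h0 := preim_subspace (mulr_linear_r a) sI; exact h0.
by move=> _ [b _ [x Kx <-]]; rewrite /= mulrA; apply: prodset_mem.
Qed.

(** The commutation condition moves [L] to the right of [q a], which shows [q (x * a)] in [q (H K)];
    the lifting error lies in [H J], hence in [H K]. *)
Lemma Kpreim_mulr a x : K x -> I (x * a).
Proof.
move=> [Nx Lx]; move: a; apply: (@homog_ind _ _ _ gr).
  have h0 := preim_subspace (mulr_linear_r x) sI; exact h0.
move=> g a ga.
have [y Iy xy] : (q @` I) (q (x * a)).
  rewrite lprojM.
  have : prodset L (q @` Hcoset gr N g) (q x * q a).
    apply: prodset_mem => //; exists a => //.
    by apply: Hcoset_homog ga _; rewrite mulVg; case: nN.
  rewrite -(ra_commute hd); move: (q x * q a); apply: lspan_sub.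
    exact: image_subspace ql _ sI.
  move=> _ [_ [b gb <-] [c0 Lc <-]]; have [c Nc cE] := qhi_sub hL Lc.
  rewrite -cE in Lc *; rewrite -lprojM; exists (b * c) => //.
  exact: prodset_mem.
rewrite -[x * a](subrK y); apply: (subspaceD sI) => //; apply: lifted_sub_ideal.
exact/(lproj_eq _ _ hJ iJ)/esym.
Qed.

Lemma ideal_of_datum_mulr a x : I x -> I (x * a).
Proof.
move: x; apply: lspan_sub.
  have h0 := preim_subspace (mulr_linear_l a) sI; exact h0.
move=> _ [b _ [x Kx <-]]; rewrite /= -mulrA.
by apply: ideal_of_datum_mull; apply: Kpreim_mulr.
Qed.

(** The coideal condition for [L] lifts to some [t] with the same image as [Delta x]; by [quo2_ker]
    the difference lies in the coideal of [H J], which is contained in [I]. *)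
Lemma Kpreim_Delta x : K x -> tcoideal I [set: H] (Delta x).
Proof.
move=> [Nx Lx]; have S := tcoideal_subspace I [set: H].
pose Q := quo2 (lifted gr J).
have Ql : linear Q := @quo2_linear _ _ (lifted gr J).
have [t It tE] : (Q @` tcoideal I [set: H]) (Delta (q x)).
  move: (Delta (q x)) (qhi_Delta hL Lx); apply: tcoideal_sub.
  - exact: image_subspace Ql _ S.
  - move=> u v Lu [v0 _ <-]; have [u0 Nu uE] := qhi_sub hL Lu; rewrite -uE in Lu *.
    exists (u0 \ox v0); last by rewrite /Q /quo2 tmapE.
    by apply: tcoideal_l => //; apply: Kpreim_sub_ideal.
  - move=> u v [u0 _ <-] Lv; have [v0 Nv vE] := qhi_sub hL Lv; rewrite -vE in Lv *.
    exists (u0 \ox v0); last by rewrite /Q /quo2 tmapE.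
    by apply: tcoideal_r => //; apply: Kpreim_sub_ideal.
rewrite lproj_Delta -/Q in tE; move: (Delta x) tE => D tE.
suff h : tcoideal I [set: H] (D - t) by have := subspaceD S h It; rewrite subrK.
have : Q (D - t) = 0 by rewrite (linB Ql) tE subrr.
move=> /quo2_ker; rewrite (liftedE hJ iJ).
move: (D - t); apply: tcoideal_sub => [//|u v Ju Jv|u v Ju Jv].
  by apply: tcoideal_l; first exact: lifted_sub_ideal.
by apply: tcoideal_r; last exact: lifted_sub_ideal.
Qed.

Lemma ideal_of_datum_qh_ideal : qh_ideal [set: H] (ideal_of_datum d).
Proof.
rewrite ideal_of_datumE; split=> //.
- by move=> a x _; apply: ideal_of_datum_mull.
- by move=> a x _; apply: ideal_of_datum_mulr.
- have S := tcoideal_subspace I [set: H].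
  apply: lspan_sub.
    have h0 := preim_subspace (@Delta_linear k H) S; exact h0.
  move=> _ [a _ [x Kx <-]]; rewrite /preimage /=.
  have -> : Delta (a * x) = Delta a * Delta x by rewrite rmorphM.
  by apply: tcoideal_mull (Kpreim_Delta Kx) => b y; apply: ideal_of_datum_mull.
- apply: lspan_sub.
    have h0 := preim_subspace (@eps_linear k H) (subspace_set0 _); exact h0.
  move=> _ [a _ [x Kx <-]]; rewrite /preimage /= rmorphM /= (Kpreim_eps Kx).
  exact: mulr0.
- apply: lspan_sub.
    have h0 := preim_subspace (@antip_linear k H) sI; exact h0.
  move=> _ [a _ [x Kx <-]]; rewrite /preimage /= antipM.
  exact: ideal_of_datum_mulr (Kpreim_sub_ideal (Kpreim_antip Kx)).
Qed.

Lemma ideal_of_datum_proj x : I x -> K (coset_proj gr N 1 x).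
Proof.
move: x; apply: prodset_ideal_Hsub => //; first exact: Kpreim_subspace.
- by move=> x [].
- exact: Kpreim_mull.
Qed.

Lemma ideal_of_datum_Hsub : I `&` Hsub gr N = K.
Proof.
rewrite eqEsubset; split=> [x [Ix Nx]|x Kx].
  by rewrite -(coset_proj_id Nx); apply: ideal_of_datum_proj.
by split; [exact: Kpreim_sub_ideal|case: Kx].
Qed.

(** An element of [I] of degree [1] lies in [K], so triviality of the datum makes its class zero; it
    then lies in [H J], whose neutral part is [J]. *)
Lemma ideal_of_datum_neutral : I `&` gr 1%g = J.
Proof.
rewrite eqEsubset; split=> [x [Ix gx]|x Jx]; last first.
  by split; [exact: Kpreim_sub_ideal (dJ_sub_Kpreim Jx)|exact: (qhi_sub hJ)].
have Nx : Hsub gr N x by apply: Hsub_homog gx _; case: nN.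
have [_ Lx] : K x by rewrite -ideal_of_datum_Hsub.
have : [set 0] (q x) by rewrite -(ra_trivial hd); split=> //; exists x.
rewrite -[0](lin0 ql) => /(lproj_eq _ _ hJ iJ); rewrite subr0.
exact (@prodset_homog1 _ _ _ gr J hJ x gx).
Qed.

(* Pairing [pi(x)] with the indicator of [N] gives [eps] of the component of [x] in
   [H_N], which vanishes for [x] in the ideal; so [zeta_g - 1] lies in the image of
   the ideal only if [g] is in [N]. *)
Lemma ideal_of_datum_Nideal : Nideal gr I = N.
Proof.
rewrite eqEsubset; split=> [g [x Ix xE]|g Ng].
  have := eps_hscale gr (coset_indicator k N 1) x.
  rewrite -/(coset_proj gr N 1 x) (Kpreim_eps (ideal_of_datum_proj Ix)).
  rewrite xE (linB (mlin_linear _)) !mlinU1 /coset_indicator !invg1 !mul1g.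
  have N1 : N 1%g by case: nN.
  rewrite (asboolT N1).
  case: asboolP => // _ /eqP; rewrite eq_sym sub0r oppr_eq0.
  by rewrite oner_eq0.
have [y Ly yE] := ra_aug hd (sub_lspan (ex_intro2 _ _ g Ng erefl)).
have [x Nx xy] := qhi_sub hL Ly; rewrite -xy in Ly yE.
rewrite lgrmapE in yE.
by exists x => //; apply: Kpreim_sub_ideal.
Qed.

Lemma datum_of_ideal_eq : datum_of_ideal gr I = d.
Proof.
have LE : L = q @` (I `&` Hsub gr N).
  rewrite ideal_of_datum_Hsub eqEsubset; split=> [y Ly|_ [x [_ Lx] <-]] //.
  have [x Nx xy] := qhi_sub hL Ly; exists x => //; split=> //.
  by rewrite /preimage /= xy.
(* The type of the third component depends on the second, so the neutral part is replaced by [J] in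
   both at once; only then can [LE] be used. *)
rewrite /datum_of_ideal ideal_of_datum_Nideal ideal_of_datum_neutral.
by rewrite -LE; case: (d).
Qed.

End IdealOfDatum.

Theorem corollary5p7 (k : fieldType) (G : groupType) (H : quasiHopfType k)
    (gr : qhGrading G H) (faithful_gr : faithfully_graded gr) :
  [/\ forall I : set H, qh_ideal [set: H]%classic I ->
        reduced_admissible (datum_of_ideal gr I),
      forall d : datum gr, reduced_admissible d ->
        qh_ideal [set: H]%classic (ideal_of_datum d),
      forall I : set H, qh_ideal [set: H]%classic I ->
        ideal_of_datum (datum_of_ideal gr I) = I
    & forall d : datum gr, reduced_admissible d ->
        datum_of_ideal gr (ideal_of_datum d) = d].
Proof.
split=> [I hI|d hd|I hI|d hd].
- exact: datum_of_ideal_admissible.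
- exact: ideal_of_datum_qh_ideal.
- exact: datum_of_idealK.
- by rewrite ideal_of_datumE //; exact: datum_of_ideal_eq.
Qed.
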